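(* Let $\rho_{AB}$ be a density matrix on a bipartite Hilbert space $\mathcal H_A\otimes\mathcal H_B$. Let $|\sqrt{\rho_{AB}}\rangle\rangle\in \mathcal H_A\otimes\mathcal H_B\otimes\mathcal H_A^*\otimes\mathcal H_B^*$ be its canonical purification, and let $\rho_{ABB^*}$ and $\rho_{AA^*B}$ be the reduced states of this purification on the indicated subsystems. Then $$S_R(A:B)-I(A:B)\;\ge\;-\max_{\mathcal R_{B\to BB^*}}\log F\big(\rho_{ABB^*},\,\mathcal R_{B\to BB^*}(\rho_{AB})\big)$$ and $$S_R(A:B)-I(A:B)\;\ge\;-\max_{\mathcal R_{A\to AA^*}}\log F\big(\rho_{AA^*B},\,\mathcal R_{A\to AA^*}(\rho_{AB})\big),$$ where the maxima are over all quantum channels $\mathcal R_{B\to BB^*}$ from $B$ to $BB^*$ (acting as the identity on $A$), respectively $\mathcal R_{A\to AA^*}$ from $A$ to $AA^*$ (acting as the identity on $B$).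
   Context: An operator $X$ on a Hilbert space $\mathcal H$ is identified with a vector $|X\rangle\rangle\in\mathcal H\otimes\mathcal H^*$, with inner product $\langle\langle X|Y\rangle\rangle=\mathrm{Tr}(X^\dagger Y)$. For a density matrix $\rho$ on $\mathcal H$, the vector $|\sqrt\rho\rangle\rangle$ is a purification of $\rho$, i.e. its reduced state on $\mathcal H$ is $\rho$; it is called the canonical purification. For $\mathcal H=\mathcal H_A\otimes\mathcal H_B$, the dual factors $\mathcal H_A^*,\mathcal H_B^*$ are labeled $A^*,B^*$. $S$ denotes the von Neumann entropy $S(\rho)=-\mathrm{Tr}\,\rho\log\rho$ (natural logarithm). The reflected entropy $S_R(A:B)$ is the von Neumann entropy of the reduced state of $|\sqrt{\rho_{AB}}\rangle\rangle$ on $AA^*$. The mutual information is $I(A:B)=S(\rho_A)+S(\rho_B)-S(\rho_{AB})$. The fidelity is $F(\rho,\sigma)=\big[\mathrm{Tr}\sqrt{\sqrt\rho\,\sigma\sqrt\rho}\,\big]^2$. A quantum channel is a completely positive trace-preserving linear map. *)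

(* Defs.v *)
From mathcomp Require Import all_boot all_order all_algebra.
From mathcomp Require Import complex mxtens.
From mathcomp Require Import boolp classical_sets reals constructive_ereal exp.

Set Implicit Arguments.
Unset Strict Implicit.
Unset Printing Implicit Defensive.

Import Order.TTheory GRing.Theory Num.Theory.
Local Open Scope ring_scope.
Local Open Scope sesquilinear_scope.
Local Open Scope complex_scope.

(* Hilbert spaces are C^n with its standard orthonormal basis; operators on   *)
(* C^m (x) C^n are matrices of size m * n, the basis of the tensor product    *)
(* being indexed as for tensmx, by mxtens_index : 'I_m * 'I_n -> 'I_(m * n).  *)

Definition is_max d (T : porderType d) (E : set T) (x : T) : Prop :=
  E x /\ ubound E x.

Section Operators.
Variable R : realType.
Local Notation C := R[i].

(* Over C, 0 <= z says that z is real and nonnegative, so that a positive     *)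
(* semidefinite matrix is Hermitian.                                          *)
Definition psdmx n (A : 'M[C]_n) : Prop :=
  forall v : 'cV[C]_n, 0 <= (v ^t* *m A *m v) 0 0.

Definition density n (rho : 'M[C]_n) : Prop := psdmx rho /\ \tr rho = 1.

(* Functional calculus, meaningful for A normal.                              *)
Definition funmx (f : C -> C) n (A : 'M[C]_n) : 'M[C]_n :=
  invmx (spectralmx A) *m diag_mx (map_mx f (spectral_diag A))
    *m spectralmx A.

Definition sqrtmx n (A : 'M[C]_n) : 'M[C]_n := funmx sqrtC A.

(* As ln 0 = 0, the logarithm is only taken on the support of A; this         *)
(* implements the convention 0 log 0 = 0 in the entropy.                      *)
Definition logmx n (A : 'M[C]_n) : 'M[C]_n :=
  funmx (fun z : C => (ln (complex.Re z))%:C) A.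

Definition entropy n (rho : 'M[C]_n) : R :=
  - complex.Re (\tr (rho *m logmx rho)).

Definition fidelity n (rho sigma : 'M[C]_n) : R :=
  (complex.Re (\tr (sqrtmx (sqrtmx rho *m sigma *m sqrtmx rho)))) ^+ 2.

Definition ptrace_left m n (X : 'M[C]_(m * n)) : 'M[C]_n :=
  \matrix_(j, j') \sum_(i < m) X (mxtens_index (i, j)) (mxtens_index (i, j')).

Definition ptrace_right m n (X : 'M[C]_(m * n)) : 'M[C]_m :=
  \matrix_(i, i') \sum_(j < n) X (mxtens_index (i, j)) (mxtens_index (i', j)).

(* The reduced state on C^m of the pure state psi of C^m (x) C^n.             *)
Definition reduced m n (psi : 'cV[C]_(m * n)) : 'M[C]_m :=
  ptrace_right (psi *m psi ^t*).

(* id (x) Phi and Phi (x) id, the second (resp. first) tensor factor being    *)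
(* acted upon: the block of X with fixed indices in the other factor is       *)
(* mapped by Phi.                                                             *)
Definition id_tens k n p (Phi : {linear 'M[C]_n -> 'M[C]_p})
    (X : 'M[C]_(k * n)) : 'M[C]_(k * p) :=
  \matrix_(s, t)
    Phi (\matrix_(j, j') X (mxtens_index ((mxtens_unindex s).1, j))
                           (mxtens_index ((mxtens_unindex t).1, j')))
      (mxtens_unindex s).2 (mxtens_unindex t).2.

Definition tens_id k n p (Phi : {linear 'M[C]_n -> 'M[C]_p})
    (X : 'M[C]_(n * k)) : 'M[C]_(p * k) :=
  \matrix_(s, t)
    Phi (\matrix_(i, i') X (mxtens_index (i, (mxtens_unindex s).2))
                           (mxtens_index (i', (mxtens_unindex t).2)))
      (mxtens_unindex s).1 (mxtens_unindex t).1.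

Definition completely_positive n p (Phi : {linear 'M[C]_n -> 'M[C]_p}) : Prop :=
  forall (k : nat) (X : 'M[C]_(k * n)), psdmx X -> psdmx (id_tens Phi X).

Definition trace_preserving n p (Phi : {linear 'M[C]_n -> 'M[C]_p}) : Prop :=
  forall X : 'M[C]_n, \tr (Phi X) = \tr X.

Definition channel n p (Phi : {linear 'M[C]_n -> 'M[C]_p}) : Prop :=
  completely_positive Phi /\ trace_preserving Phi.

(* |X>> in H (x) H^*, where H^* carries the dual basis.                       *)
Definition vectorize n (X : 'M[C]_n) : 'cV[C]_(n * n) :=
  \col_k X (mxtens_unindex k).1 (mxtens_unindex k).2.

Definition canonical_purification n (rho : 'M[C]_n) : 'cV[C]_(n * n) :=
  vectorize (sqrtmx rho).

End Operators.

Section Bipartite.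
Variables (R : realType) (dA dB : nat).
Local Notation C := R[i].

(* The coefficient of psi, in A (x) B (x) A^* (x) B^*, on |a>|b>|a'>|b'>.     *)
Definition coef (psi : 'cV[C]_((dA * dB) * (dA * dB)))
    (a : 'I_dA) (b : 'I_dB) (a' : 'I_dA) (b' : 'I_dB) : C :=
  psi (mxtens_index (mxtens_index (a, b), mxtens_index (a', b'))) 0.

(* The vector psi with its tensor factors reordered as indicated.             *)
Definition regroup_AAs_BBs (psi : 'cV[C]_((dA * dB) * (dA * dB))) :
    'cV[C]_((dA * dA) * (dB * dB)) :=
  \col_k let: (aa, bb) := mxtens_unindex k in
         let: (a, a') := mxtens_unindex aa in
         let: (b, b') := mxtens_unindex bb in coef psi a b a' b'.

Definition regroup_ABBs_As (psi : 'cV[C]_((dA * dB) * (dA * dB))) :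
    'cV[C]_((dA * (dB * dB)) * dA) :=
  \col_k let: (abb, a') := mxtens_unindex k in
         let: (a, bb) := mxtens_unindex abb in
         let: (b, b') := mxtens_unindex bb in coef psi a b a' b'.

Definition regroup_AAsB_Bs (psi : 'cV[C]_((dA * dB) * (dA * dB))) :
    'cV[C]_(((dA * dA) * dB) * dB) :=
  \col_k let: (aab, b') := mxtens_unindex k in
         let: (aa, b) := mxtens_unindex aab in
         let: (a, a') := mxtens_unindex aa in coef psi a b a' b'.

Variable rho : 'M[C]_(dA * dB).

Definition rho_AAs : 'M[C]_(dA * dA) :=
  reduced (regroup_AAs_BBs (canonical_purification rho)).

Definition rho_ABBs : 'M[C]_(dA * (dB * dB)) :=
  reduced (regroup_ABBs_As (canonical_purification rho)).

Definition rho_AAsB : 'M[C]_((dA * dA) * dB) :=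
  reduced (regroup_AAsB_Bs (canonical_purification rho)).

Definition reflected_entropy : R := entropy rho_AAs.

Definition mutual_information : R :=
  entropy (ptrace_right rho) + entropy (ptrace_left rho) - entropy rho.

End Bipartite.

(* Main.v *)
Require Import Defs.
From HB Require Import structures.
From mathcomp Require Import all_boot all_order all_algebra.
From mathcomp Require Import complex mxtens ring lra.
From mathcomp Require Import boolp classical_sets reals constructive_ereal topology normedtype sequences derive exp trigo.

(** Writing A' and B' for the dual factors, S_R - I is the conditional mutual
information I(A:B'|B) of the state rho on A B B', so the theorem is a case of
the Fawzi-Renner inequality. Let X, Y, Z be the marginals of rho on B B', B and
A B, padded with identities, and consider the scalar function f(z) = tr (rho
rho^(-z/2) X^(z/2) Y^(-z/2) Z^(z/2)), a finite sum of exponentials c e^(a z)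
with a real. On the line Re z = 0 it is bounded by 1 (Cauchy-Schwarz), and on Re
z = 1 by the root fidelity between rho and the image of its A B marginal under a
rotated Petz map, hence by the best root fidelity m. Also f(0) = 1 and f'(0) = -
I(A:B'|B) / 2. The maximum principle on the strip, applied to f(z) m^(-z), gives
f'(0) <= ln m.

The maximum over channels is attained: the channels form a compact set, and the
root fidelity is upper semicontinuous, since tr sqrt T is the infimum of (tr Y +
tr (T Y^(-1))) / 2 over positive definite Y. The second inequality is the first
one for the state with A and B swapped. *)

Set Implicit Arguments.
Unset Strict Implicit.
Unset Printing Implicit Defensive.

Import Order.TTheory GRing.Theory Num.Theory.
Local Open Scope ring_scope.
Local Open Scope sesquilinear_scope.

(** The identity with I(A:B'|B) comes from purity: S(A B B') is the entropy of A', whose state is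
    the transpose of rho_A, and S(B B') is S_R because B B' is the complement of A A'. One bound m,
    valid for all channels, controls every rotation at once, so that a maximum principle suffices
    and no average over rotations against a Poisson kernel appears. The halved exponents turn the
    line Re z = 1 into a root fidelity, and F = m^2 restores the factor 2.

    States may be singular. Powers vanish at the eigenvalue 0, so at z = 0 they are support
    projections; these act as the identity on rho, whose support lies in those of its padded
    marginals. For the same reason the Petz map gets a correction on a kernel to be a channel, and
    that correction vanishes on the A B marginal.

    No holomorphy is used. Only the real part of f(z) m^(-z) matters: its five-point Laplacians are
    o(h^2), and a quadratic barrier makes them strictly positive and controls large ordinates on the
    unbounded strip. The derivative at 0 is read off the exponents, which avoids differentiating
    matrix functions. *)

Section Matrices.
Variable C : numClosedFieldType.

Lemma adjmxM m n p (A : 'M[C]_(m, n)) (B : 'M[C]_(n, p)) :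
  (A *m B)^t* = B^t* *m A^t*.
Proof. by rewrite trmx_mul map_mxM. Qed.

Lemma adjmxD m n (A B : 'M[C]_(m, n)) : (A + B)^t* = A^t* + B^t*.
Proof. by rewrite linearD map_mxD. Qed.

Lemma adjmxB m n (A B : 'M[C]_(m, n)) : (A - B)^t* = A^t* - B^t*.
Proof. by rewrite linearB map_mxB. Qed.

Lemma adjmx1 n : (1%:M : 'M[C]_n)^t* = 1%:M.
Proof. by rewrite trmx1 map_mx1. Qed.

Lemma adj_diag_mx n (d : 'rV[C]_n) : (diag_mx d)^t* = diag_mx (map_mx Num.conj d).
Proof. by rewrite tr_diag_mx map_diag_mx. Qed.

(** * Functional calculus *)

Lemma unitarymxK n (U : 'M[C]_n) : U \is unitarymx -> U *m U^t* = 1%:M /\ U^t* *m U = 1%:M.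
Proof. by move=> /unitarymxP UU; split=> //; apply: mulmx1C. Qed.

(** Agrees with [funmx], the eigenbasis being unitary; with the adjoint in place of the inverse,
    positivity is visible as a congruence. *)
Definition fcalc (f : C -> C) n (A : 'M[C]_n) : 'M[C]_n :=
  (spectralmx A)^t* *m diag_mx (map_mx f (spectral_diag A)) *m spectralmx A.

Lemma normalmx_spectral n (A : 'M[C]_n) : A \is normalmx ->
  A = (spectralmx A)^t* *m diag_mx (spectral_diag A) *m spectralmx A.
Proof.
move=> /orthomx_spectralP {1}->; by rewrite invmx_unitary // spectral_unitarymx.
Qed.

(* In the two eigenbases the intertwiner K only connects equal eigenvalues. *)
Lemma intertwine_diag m n (U : 'M[C]_m) (V : 'M[C]_n) (d : 'rV[C]_m) (e : 'rV[C]_n)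
    (K : 'M[C]_(m, n)) f : U \is unitarymx -> V \is unitarymx ->
  (U^t* *m diag_mx d *m U) *m K = K *m (V^t* *m diag_mx e *m V) ->
  (U^t* *m diag_mx (map_mx f d) *m U) *m K = K *m (V^t* *m diag_mx (map_mx f e) *m V).
Proof.
move=> /unitarymxK[UU UU'] /unitarymxK[VV VV'] h.
pose W := U *m K *m V^t*.
have hW : diag_mx d *m W = W *m diag_mx e.
  have -> : diag_mx d *m W = U *m (U^t* *m diag_mx d *m U *m K) *m V^t*.
    by rewrite /W !mulmxA UU mul1mx.
  by rewrite h /W !mulmxA -[LHS]mulmxA VV mulmx1.
have fW : diag_mx (map_mx f d) *m W = W *m diag_mx (map_mx f e).
  clear -hW; move: W hW => W hW.
  apply/matrixP => i j; have /matrixP/(_ i j) := hW.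
  rewrite !mul_diag_mx !mul_mx_diag !mxE [RHS]mulrC.
  have [->|w0] := eqVneq (W i j) 0; first by rewrite !mulr0 mul0r.
  by move=> /(mulIf w0) ->; rewrite mulrC.
transitivity (U^t* *m (diag_mx (map_mx f d) *m W) *m V).
  by rewrite /W !mulmxA -[RHS]mulmxA VV' mulmx1.
by rewrite fW /W !mulmxA UU' mul1mx.
Qed.

(** The identity intertwines the two diagonalizations, so the calculus does not depend on the
    eigenbasis picked by [spectralmx]. *)
Lemma fcalc_diag n (U : 'M[C]_n) (d : 'rV[C]_n) f (A : 'M[C]_n) : U \is unitarymx ->
  A = U^t* *m diag_mx d *m U -> fcalc f A = U^t* *m diag_mx (map_mx f d) *m U.
Proof.
move=> Uu AE.
have nA : A \is normalmx.
  apply/orthomx_spectral_subproof; exists (U, d) => //=.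
  by rewrite invmx_unitary.
have := @intertwine_diag n n (spectralmx A) U (spectral_diag A) d 1%:M f
  (spectral_unitarymx A) Uu.
by rewrite -normalmx_spectral // !mulmx1 !mul1mx -AE -/(fcalc f A); apply.
Qed.

Lemma fcalc_intertwine m n (A : 'M[C]_m) (B : 'M[C]_n) (K : 'M[C]_(m, n)) f :
  A \is normalmx -> B \is normalmx -> A *m K = K *m B ->
  fcalc f A *m K = K *m fcalc f B.
Proof.
move=> nA nB h; rewrite !/fcalc; apply: intertwine_diag; rewrite ?spectral_unitarymx //.
by rewrite -!normalmx_spectral.
Qed.

Lemma fcalcM f g n (A : 'M[C]_n) :
  fcalc f A *m fcalc g A = fcalc (fun x => f x * g x) A.
Proof.
have [UU _] := unitarymxK (spectral_unitarymx A).
rewrite !/fcalc; move: (spectralmx A) UU => U UU.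
rewrite -!mulmxA (mulmxA U) UU mul1mx (mulmxA (diag_mx _) (diag_mx _)) mulmx_diag.
by do 2!congr (_ *m _); congr (diag_mx _); apply/rowP => i; rewrite !mxE.
Qed.

Lemma fcalc_adj f n (A : 'M[C]_n) : (fcalc f A)^t* = fcalc (fun x => (f x)^*%R) A.
Proof.
rewrite !/fcalc !adjmxM trmxCK adj_diag_mx mulmxA; do 2!congr (_ *m _).
by congr (diag_mx _); apply/rowP => i; rewrite !mxE.
Qed.

Lemma fcalc_id n (A : 'M[C]_n) : A \is normalmx -> fcalc id A = A.
Proof.
move=> nA; rewrite /fcalc [RHS]normalmx_spectral //.
by rewrite (_ : map_mx id _ = spectral_diag A) //; apply/rowP => i; rewrite mxE.
Qed.

Lemma eq_fcalc f g n (A : 'M[C]_n) :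
  (forall i, f (spectral_diag A 0 i) = g (spectral_diag A 0 i)) -> fcalc f A = fcalc g A.
Proof.
move=> fg; rewrite !/fcalc; congr (_ *m diag_mx _ *m _).
by apply/rowP => i; rewrite !mxE.
Qed.

Lemma fcalc1 n (A : 'M[C]_n) : fcalc (fun=> 1) A = 1%:M.
Proof.
have [_ UU] := unitarymxK (spectral_unitarymx A).
rewrite /fcalc (_ : map_mx _ (spectral_diag A) = const_mx 1) ?diag_const_mx ?mulmx1 ?UU //.
by apply/rowP => i; rewrite !mxE.
Qed.

Lemma fcalcD f g n (A : 'M[C]_n) : fcalc f A + fcalc g A = fcalc (fun x => f x + g x) A.
Proof.
rewrite !/fcalc -mulmxDl -mulmxDr; congr (_ *m _ *m _).
by rewrite -linearD; congr (diag_mx _); apply/rowP => i; rewrite !mxE.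
Qed.

Lemma fcalcZ a f n (A : 'M[C]_n) : a *: fcalc f A = fcalc (fun x => a * f x) A.
Proof.
rewrite !/fcalc scalemxAl scalemxAr; congr (_ *m _ *m _).
by rewrite -linearZ; congr (diag_mx _); apply/rowP => i; rewrite !mxE.
Qed.

Lemma mxtrace_fcalc f n (A : 'M[C]_n) : \tr (fcalc f A) = \sum_i f (spectral_diag A 0 i).
Proof.
have [UU _] := unitarymxK (spectral_unitarymx A).
rewrite /fcalc mxtrace_mulC mulmxA UU mul1mx mxtrace_diag.
by apply: eq_bigr => i _; rewrite mxE.
Qed.

Lemma fcalc_comm f g n (A : 'M[C]_n) : fcalc f A *m fcalc g A = fcalc g A *m fcalc f A.
Proof. by rewrite !fcalcM; apply: eq_fcalc => i; rewrite mulrC. Qed.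

(** * Positive semidefinite matrices *)

(** Same body as [psdmx], over any closed numeric field, so that the two are convertible over
    [R[i]]. *)
Definition psd n (A : 'M[C]_n) : Prop :=
  forall v : 'cV[C]_n, 0 <= (v ^t* *m A *m v) 0 0.

Lemma psd_congr m n (A : 'M[C]_n) (K : 'M[C]_(m, n)) :
  psd A -> psd (K *m A *m K^t*).
Proof.
by move=> A0 v; have := A0 (K^t* *m v); rewrite adjmxM trmxCK !mulmxA.
Qed.

Lemma psd1 n : psd (1%:M : 'M[C]_n).
Proof.
move=> v; rewrite mulmx1 mxE; apply: sumr_ge0 => i _.
by rewrite !mxE mulrC mul_conjC_ge0.
Qed.

Lemma psd_gram m n (K : 'M[C]_(m, n)) : psd (K *m K^t*).
Proof. by have := psd_congr K (@psd1 n); rewrite mulmx1. Qed.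

Lemma psdD n (A B : 'M[C]_n) : psd A -> psd B -> psd (A + B).
Proof. by move=> A0 B0 v; rewrite mulmxDr mulmxDl mxE addr_ge0. Qed.

Lemma psdZ n (a : C) (A : 'M[C]_n) : 0 <= a -> psd A -> psd (a *: A).
Proof. by move=> a0 A0 v; rewrite -scalemxAr -scalemxAl mxE mulr_ge0. Qed.

Lemma delta_formE n (A : 'M[C]_n) i j :
  ((delta_mx i 0 : 'cV[C]_n)^t* *m A *m (delta_mx j 0 : 'cV[C]_n)) 0 0 = A i j.
Proof. by rewrite trmx_delta map_delta_mx -rowE -colE !mxE. Qed.

(* Polarization: the quadratic forms at v + w and v + i w are real. *)
Lemma psd_adj n (A : 'M[C]_n) : psd A -> A^t* = A.
Proof.
move=> A0.
pose q (v w : 'cV[C]_n) : C := (v^t* *m A *m w) 0 0.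
have q_adj v w : (v^t* *m A^t* *m w) 0 0 = (q w v)^*%R.
  have conj00 (X : 'M[C]_1) : (X 0 0)^*%R = (X^t*) 0 0 by rewrite !mxE.
  by rewrite /q conj00 !adjmxM trmxCK mulmxA.
have real v : (q v v)^*%R = q v v by apply/CrealP; rewrite realE A0.
have add00 (X Y : 'M[C]_1) : (X + Y) 0 0 = X 0 0 + Y 0 0 by rewrite mxE.
have scale00 a (X : 'M[C]_1) : (a *: X) 0 0 = a * X 0 0 by rewrite mxE.
have qD v w : q (v + w) (v + w) = q v v + q v w + q w v + q w w.
  by rewrite /q adjmxD !mulmxDl !mulmxDr !add00; ring.
suff qq v w : q v w = (q w v)^*%R.
  apply/matrixP => i j.
  by rewrite -[RHS]delta_formE -/(q _ _) qq -q_adj delta_formE.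
have e1 := real (v + w); have e2 := real (v + 'i *: w).
have qZr v' w' : q v' ('i *: w') = 'i * q v' w' by rewrite /q -scalemxAr scale00.
have qZl v' w' : q ('i *: v') w' = - 'i * q v' w'.
  rewrite /q; have -> : ('i *: v')^t* = - 'i *: v'^t*.
    by apply/matrixP => i j; rewrite !mxE rmorphM /= conjCi.
  by rewrite -!scalemxAl scale00.
clearbody q; move: e1 e2; rewrite !qD !qZl !qZr !rmorphD /= !rmorphM /= !rmorphN /= !conjCi !real.
move: (q v v) (q w w) (q v w) (q w v) => a b x y e1 e2.
(* The first reality identity times the imaginary unit, added to the second, isolates [x - y^*]. *)
have : 2 * 'i * (x - y^*%R) = 0.
  transitivity ('i * ((a + x + y + b) - (a + x^*%R + y^*%R + b)) +
    ((a + 'i * x + - 'i * y + - 'i * ('i * b)) -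
     (a + - 'i * x^*%R + - - 'i * y^*%R + - - 'i * (- 'i * b)))); first by ring.
  by rewrite e1 e2 !subrr mulr0 addr0.
move/eqP; rewrite !mulf_eq0 pnatr_eq0 /= (negPf (neq0Ci _)) /= subr_eq0.
by move/eqP.
Qed.

End Matrices.

Section Positive.
Variable C : numClosedFieldType.

Lemma psd_normal n (A : 'M[C]_n) : psd A -> A \is normalmx.
Proof. by move=> A0; apply/normalmxP; rewrite psd_adj. Qed.

Lemma psd_diag_ge0 n (A : 'M[C]_n) i : psd A -> 0 <= A i i.
Proof. by move=> /(_ (delta_mx i 0)); rewrite delta_formE. Qed.

Lemma mxtrace_psd n (A : 'M[C]_n) : psd A -> 0 <= \tr A.
Proof. by move=> A0; apply: sumr_ge0 => i _; apply: psd_diag_ge0. Qed.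

Lemma psd_spectral_ge0 n (A : 'M[C]_n) i : psd A -> 0 <= spectral_diag A 0 i.
Proof.
move=> A0; have [UU UU'] := unitarymxK (spectral_unitarymx A).
have := psd_diag_ge0 i (psd_congr (spectralmx A) A0).
move: (normalmx_spectral (psd_normal A0)) UU.
move: (spectralmx A) (spectral_diag A) => U d -> UU.
by rewrite !mulmxA UU mul1mx -mulmxA UU mulmx1 mxE eqxx mulr1n.
Qed.

Lemma psd_diag_mx n (d : 'rV[C]_n) : (forall i, 0 <= d 0 i) -> psd (diag_mx d).
Proof.
move=> d0; pose s := map_mx sqrtC d.
have -> : diag_mx d = diag_mx s *m (diag_mx s)^t*; last exact: psd_gram.
rewrite adj_diag_mx mulmx_diag; congr (diag_mx _); apply/rowP => i; rewrite !mxE.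
by rewrite geC0_conj ?sqrtC_ge0 // -expr2 sqrtCK.
Qed.

Lemma psd_fcalc f n (A : 'M[C]_n) : (forall i, 0 <= f (spectral_diag A 0 i)) ->
  psd (fcalc f A).
Proof.
move=> f0; rewrite /fcalc -[X in _ *m X]trmxCK; apply: psd_congr.
by apply: psd_diag_mx => i; rewrite mxE.
Qed.

Lemma eq_fcalc_psd f g n (A : 'M[C]_n) : psd A ->
  (forall x, 0 <= x -> f x = g x) -> fcalc f A = fcalc g A.
Proof. by move=> A0 fg; apply: eq_fcalc => i; rewrite fg // psd_spectral_ge0. Qed.

Lemma fcalc_adj_real f n (A : 'M[C]_n) : psd A ->
  (forall x, 0 <= x -> f x \is Num.real) -> (fcalc f A)^t* = fcalc f A.
Proof.
by move=> A0 fr; rewrite fcalc_adj; apply: eq_fcalc_psd => // x /fr /CrealP.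
Qed.

Lemma fcalc_id_psd n (A : 'M[C]_n) : psd A -> fcalc id A = A.
Proof. by move=> /psd_normal /fcalc_id. Qed.

Lemma fcalc_sandwich f g n (A : 'M[C]_n) : psd A ->
  fcalc f A *m A *m fcalc g A = fcalc (fun x => f x * x * g x) A.
Proof.
move=> A0; transitivity (fcalc f A *m fcalc id A *m fcalc g A).
  by rewrite (fcalc_id_psd A0).
by rewrite !fcalcM.
Qed.

Definition rootmx n (A : 'M[C]_n) := fcalc sqrtC A.

Lemma rootmx_psd n (A : 'M[C]_n) : psd A -> psd (rootmx A).
Proof. by move=> A0; apply: psd_fcalc => i; rewrite sqrtC_ge0 psd_spectral_ge0. Qed.

Lemma rootmxK n (A : 'M[C]_n) : psd A -> rootmx A *m rootmx A = A.
Proof.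
move=> A0; rewrite fcalcM -[RHS]fcalc_id_psd //.
by apply: eq_fcalc => i; rewrite -expr2 sqrtCK.
Qed.

Lemma rootmx_adj n (A : 'M[C]_n) : psd A -> (rootmx A)^t* = rootmx A.
Proof. by move=> /rootmx_psd /psd_adj. Qed.

Lemma mxtrace_mul_psd n (A B : 'M[C]_n) : psd A -> psd B -> 0 <= \tr (A *m B).
Proof.
move=> A0 B0; rewrite -[A]rootmxK // mxtrace_mulC mulmxA -mxtrace_mulC mulmxA.
by apply: mxtrace_psd; rewrite -{2}rootmx_adj //; apply: psd_congr.
Qed.

(** * The Hilbert-Schmidt norm *)

Definition hsnorm2 m n (A : 'M[C]_(m, n)) : C := \tr (A *m A^t*).

Lemma hsnorm2E m n (A : 'M[C]_(m, n)) : hsnorm2 A = \sum_i \sum_j `|A i j| ^+ 2.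
Proof.
by apply: eq_bigr => i _; rewrite mxE; apply: eq_bigr => j _; rewrite !mxE normCK.
Qed.

Lemma hsnorm2_ge0 m n (A : 'M[C]_(m, n)) : 0 <= hsnorm2 A.
Proof. exact/mxtrace_psd/psd_gram. Qed.

Lemma hsnorm2_eq0 m n (A : 'M[C]_(m, n)) : hsnorm2 A = 0 -> A = 0.
Proof.
rewrite hsnorm2E => /eqP; rewrite psumr_eq0; last first.
  by move=> i _; apply: sumr_ge0 => j _; rewrite exprn_ge0.
move=> /allP A0; apply/matrixP => i j; rewrite mxE.
have := A0 i (mem_index_enum _); rewrite /= psumr_eq0; last by move=> k _; rewrite exprn_ge0.
by move=> /allP/(_ j (mem_index_enum _)) /=; rewrite expf_eq0 /= normr_eq0 => /eqP.
Qed.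

Lemma hsnorm2_adj m n (A : 'M[C]_(m, n)) : hsnorm2 (A^t*) = hsnorm2 A.
Proof. by rewrite /hsnorm2 trmxCK mxtrace_mulC. Qed.

Lemma mxtrace_mul_CauchySchwarz m n (A : 'M[C]_(m, n)) (B : 'M[C]_(n, m)) :
  `|\tr (A *m B)| ^+ 2 <= hsnorm2 A * hsnorm2 B.
Proof.
have dotE (X Y : 'M[C]_(m, n)) : \tr (X *m Y^t*) = dotmx (mxvec X) (mxvec Y).
  rewrite dotmxE mxE (reindex _ (curry_mxvec_bij _ _)) /=.
  transitivity (\sum_i \sum_j X i j * (Y i j)^*%R).
    by apply: eq_bigr => i _; rewrite mxE; apply: eq_bigr => j _; rewrite !mxE.
  rewrite pair_bigA; apply: eq_bigr => -[i j] _ /=.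
  by rewrite !mxE; rewrite !mxvecE.
have -> : hsnorm2 B = \tr (B^t* *m B^t*^t*) by rewrite -hsnorm2_adj.
have -> : \tr (A *m B) = \tr (A *m B^t*^t*) by rewrite trmxCK.
by rewrite /hsnorm2 !dotE; apply: CauchySchwarz.
Qed.

Lemma hsnorm2_mulr_unitary m n (A : 'M[C]_(m, n)) (U : 'M[C]_n) :
  U \is unitarymx -> hsnorm2 (A *m U) = hsnorm2 A.
Proof. by move=> /unitarymxK[UU _]; rewrite /hsnorm2 adjmxM mulmxA -[_ *m U *m _]mulmxA UU mulmx1. Qed.

Lemma hsnorm2_contraction f m n (A : 'M[C]_(m, n)) (B : 'M[C]_n) :
  (forall i, `|f (spectral_diag B 0 i)| <= 1) -> hsnorm2 (A *m fcalc f B) <= hsnorm2 A.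
Proof.
move=> f1; rewrite /fcalc !mulmxA hsnorm2_mulr_unitary ?spectral_unitarymx //.
set X := A *m _.
have <- : hsnorm2 X = hsnorm2 A.
  by rewrite hsnorm2_mulr_unitary // trmxC_unitary spectral_unitarymx.
rewrite !hsnorm2E; apply: ler_sum => i _; apply: ler_sum => j _.
rewrite mul_mx_diag !mxE normrM exprMn ler_piMr ?exprn_ge0 //.
by rewrite expr_le1.
Qed.

(** The trace is the squared Hilbert-Schmidt norm of sqrt A times Q. *)
Lemma mul_eq0_psd n m (A : 'M[C]_n) (Q : 'M[C]_(n, m)) :
  psd A -> \tr (Q^t* *m A *m Q) = 0 -> A *m Q = 0.
Proof.
move=> A0 h; rewrite -[A]rootmxK // -mulmxA.
suff -> : rootmx A *m Q = 0 by rewrite mulmx0.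
rewrite -[LHS]trmxCK (_ : (rootmx A *m Q)^t* = 0) ?trmx0 ?map_mx0 //.
apply: hsnorm2_eq0; rewrite /hsnorm2 trmxCK adjmxM rootmx_adj //.
by rewrite mulmxA -(mulmxA (Q^t*)) rootmxK.
Qed.

(** * The trace norm *)

Definition supp (x : C) : C := (x != 0)%:R.

Definition suppmx n (A : 'M[C]_n) := fcalc supp A.

Lemma supp_real x : supp x \is Num.real.
Proof. exact: realn. Qed.

Lemma suppmx_adj n (A : 'M[C]_n) : (suppmx A)^t* = suppmx A.
Proof. by rewrite fcalc_adj; apply: eq_fcalc => i; apply/CrealP/supp_real. Qed.

(** The squared norm of (P - 1) K, with P the support projection, is the trace of (P - 1) T (P - 1),
    which vanishes eigenvalue by eigenvalue. *)
Lemma suppmx_gram m n (K : 'M[C]_(m, n)) : suppmx (K *m K^t*) *m K = K.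
Proof.
set T := K *m K^t*; have T0 : psd T by exact: psd_gram.
apply/eqP; rewrite -subr_eq0 -[X in _ - X]mul1mx -mulmxBl; apply/eqP.
apply: hsnorm2_eq0; rewrite /hsnorm2 adjmxM adjmxB suppmx_adj adjmx1.
rewrite mulmxA -[_ *m K *m _]mulmxA -/T -[in X in _ *m X *m _](fcalc_id_psd T0).
rewrite -(fcalc1 T) -scaleN1r fcalcZ fcalcD !fcalcM mxtrace_fcalc.
rewrite big1 // => i _; rewrite /supp.
by have [->|_] := eqVneq; rewrite ?mulr0 ?mul0r // mulr1 subrr !mul0r.
Qed.

(* With T the Gram matrix of N, split N = T^(1/4) . T^(-1/4) N, where both factors have squared norm tr |N|. *)
Lemma trace_norm_ge n (N B : 'M[C]_n) f :
  (forall i, `|f (spectral_diag B 0 i)| <= 1) ->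
  `|\tr (fcalc f B *m N)| <= \tr (rootmx (N *m N^t*)).
Proof.
move=> f1; set T := N *m N^t*; have T0 : psd T by exact: psd_gram.
pose q (x : C) := sqrtC (sqrtC x).
have q_ge0 x : 0 <= x -> 0 <= q x by move=> x0; rewrite !sqrtC_ge0.
have qq x : q x * q x = sqrtC x by rewrite -expr2 sqrtCK.
have q_eq0 x : (q x == 0) = (x == 0) by rewrite !sqrtC_eq0.
(* As [0^-1 = 0], the inverse fourth root only acts on the support of [T], which contains the range
   of [N]. *)
pose G := fcalc q T; pose H := fcalc (fun x => (q x)^-1) T *m N.
have Gr : G^t* = G.
  by apply: fcalc_adj_real => // x /q_ge0/ger0_real.
have Hr : (fcalc (fun x => (q x)^-1) T)^t* = fcalc (fun x => (q x)^-1) T.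
  by apply: fcalc_adj_real => // x /q_ge0/ger0_real; rewrite rpredV.
have -> : N = G *m H.
  rewrite mulmxA fcalcM -[LHS](suppmx_gram N) -/T; congr (_ *m _).
  apply: eq_fcalc => i; rewrite /supp -q_eq0.
  by have [->|h] := eqVneq (q _) 0; rewrite ?mul0r // divff.
have nG : hsnorm2 G = \tr (rootmx T).
  by rewrite /hsnorm2 Gr fcalcM; congr (\tr _); apply: eq_fcalc => i; rewrite qq.
have nH : hsnorm2 H = \tr (rootmx T).
  rewrite /hsnorm2 adjmxM Hr mulmxA -(mulmxA _ N) -/T.
  rewrite -[X in _ *m X *m _](fcalc_id_psd T0) !fcalcM; congr (\tr _).
  apply: eq_fcalc_psd => // x x0.
  have [->|x1] := eqVneq x 0; first by rewrite mulr0 mul0r sqrtC0.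
  have q0 : q x != 0 by rewrite q_eq0.
  have xE : x = q x * q x * (q x * q x) by rewrite !qq -expr2 sqrtCK.
  by rewrite {2}xE -qq !mulrA mulVf // mul1r mulfK.
rewrite mulmxA mxtrace_mulC mulmxA.
have := mxtrace_mul_CauchySchwarz (H *m fcalc f B) G.
move=> /le_trans/(_ (ler_wpM2r (hsnorm2_ge0 _) (hsnorm2_contraction _ f1))).
by rewrite nG nH -expr2 ler_sqr ?nnegrE // -nG hsnorm2_ge0.
Qed.

(** A matrix form of the inequality between arithmetic and geometric means: expand the trace of the
    positive matrix (s - Y) Z (s - Y), where s is the root of T and Z the inverse of Y. *)
Lemma trace_root_le n (T Y Z : 'M[C]_n) : psd T -> psd Z -> Z *m Y = 1%:M ->
  2 * \tr (rootmx T) <= \tr Y + \tr (T *m Z).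
Proof.
move=> T0 Z0 ZY; have YZ := mulmx1C ZY.
set s := rootmx T; have sadj : s^t* = s by exact: rootmx_adj.
have Yadj : Y^t* = Y.
  have h : Z *m Y^t* = 1%:M by rewrite -[Z]psd_adj // -adjmxM YZ adjmx1.
  by rewrite -[LHS]mul1mx -YZ -mulmxA h mulmx1.
have := mxtrace_psd (psd_congr (s - Y) Z0).
rewrite adjmxB sadj Yadj !mulmxBl YZ !mulmxBr !mul1mx.
rewrite -(mulmxA s Z Y) ZY mulmx1.
rewrite !raddfB /= (mxtrace_mulC (s *m Z)) mulmxA rootmxK //.
set E := (X in 0 <= X) => h; rewrite -subr_ge0.
suff -> : \tr Y + \tr (T *m Z) - 2 * \tr s = E by [].
by rewrite /E; ring.
Qed.

(** The optimal Y would be the root of T, which may be singular; adding e to it makes it invertible.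
    On an eigenvalue y of the root, the excess is controlled by y^2 / (y + e) <= y. *)
Lemma trace_root_approx n (T : 'M[C]_n) (e : C) : psd T -> 0 < e ->
  exists Y Z : 'M[C]_n, [/\ psd Y, psd Z, Z *m Y = 1%:M &
    \tr Y + \tr (T *m Z) <= 2 * \tr (rootmx T) + e * n%:R].
Proof.
move=> T0 e0.
have p0 x : 0 <= x -> 0 < sqrtC x + e by move=> x0; rewrite ltr_wpDl // sqrtC_ge0.
exists (fcalc (fun x => sqrtC x + e) T), (fcalc (fun x => (sqrtC x + e)^-1) T).
split.
- by apply: psd_fcalc => i; apply/ltW/p0/psd_spectral_ge0.
- by apply: psd_fcalc => i; rewrite invr_ge0; apply/ltW/p0/psd_spectral_ge0.
- rewrite fcalcM -(fcalc1 T); apply: eq_fcalc_psd => // x /p0 x0.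
  by rewrite mulVf // gt_eqF.
rewrite -[X in \tr (X *m _)](fcalc_id_psd T0) fcalcM !mxtrace_fcalc.
rewrite mulr_sumr -big_split /=.
have -> : e * n%:R = \sum_(i < n) e by rewrite sumr_const card_ord mulr_natr.
rewrite -big_split /=; apply: ler_sum => i _.
have := psd_spectral_ge0 i T0; move: (spectral_diag T 0 i) => x x0.
have sx : 0 <= sqrtC x by rewrite sqrtC_ge0.
rewrite -[X in _ + X / _]sqrtCK; move: (p0 _ x0) sx; move: (sqrtC x) => y y0 y1.
rewrite mulr_natl mulr2n -addrA addrAC addrA lerD2r lerD2l.
by rewrite ler_pdivrMr // expr2 ler_wpM2l // lerDl ltW.
Qed.

End Positive.

(* A factorization C^n = C^m (x) C^k, given on the standard bases by i |-> (sub_in i, sub_out i). *)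
Record subsystem n m k := Subsystem {
  sub_in : 'I_n -> 'I_m;
  sub_out : 'I_n -> 'I_k;
  sub_pair : 'I_m -> 'I_k -> 'I_n;
  sub_inK : forall x c, sub_in (sub_pair x c) = x;
  sub_outK : forall x c, sub_out (sub_pair x c) = c;
  sub_pairK : forall i, sub_pair (sub_in i) (sub_out i) = i }.

(** * Padding by the identity and partial trace *)

Section Subsystems.
Variable C : numClosedFieldType.

Section OneSubsystem.
Variables (n m k : nat) (e : subsystem n m k).

Definition lift_sub (X : 'M[C]_m) : 'M[C]_n :=
  \matrix_(i, j) (X (sub_in e i) (sub_in e j) *+ (sub_out e i == sub_out e j)).

Definition ptrace_sub (X : 'M[C]_n) : 'M[C]_m :=
  \matrix_(x, y) \sum_c X (sub_pair e x c) (sub_pair e y c).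

Lemma sum_sub (F : 'I_n -> C) : \sum_i F i = \sum_x \sum_c F (sub_pair e x c).
Proof.
rewrite pair_bigA /= (reindex (fun xc : 'I_m * 'I_k => sub_pair e xc.1 xc.2)) //.
exists (fun i => (sub_in e i, sub_out e i)) => [[x c]|i] _ /=.
  by rewrite sub_inK sub_outK.
exact: sub_pairK.
Qed.

Lemma lift_subM (X Y : 'M[C]_m) : lift_sub (X *m Y) = lift_sub X *m lift_sub Y.
Proof.
apply/matrixP => i j; rewrite !mxE sum_sub -sumrMnl.
apply: eq_bigr => x _; rewrite (bigD1 (sub_out e i)) //= !mxE !sub_inK !sub_outK eqxx mulr1n.
rewrite mulrnAr big1 ?addr0 // => c /negPf ci.
by rewrite !mxE sub_inK sub_outK eq_sym ci mulr0n mul0r.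
Qed.

Lemma lift_sub_adj (X : 'M[C]_m) : lift_sub (X^t*) = (lift_sub X)^t*.
Proof.
by apply/matrixP => i j; rewrite !mxE eq_sym rmorphMn.
Qed.

Lemma lift_sub_diag (d : 'rV[C]_m) : lift_sub (diag_mx d) = diag_mx (\row_i d 0 (sub_in e i)).
Proof.
apply/matrixP => i j; rewrite !mxE -mulrnA mulnb; congr (_ *+ _).
congr nat_of_bool.
apply/andP/eqP => [[/eqP h1 /eqP h2]|->]; last by rewrite !eqxx.
by rewrite -(sub_pairK e i) h1 h2 sub_pairK.
Qed.

Lemma lift_sub1 : lift_sub 1%:M = 1%:M.
Proof.
rewrite -diag_const_mx lift_sub_diag -diag_const_mx; congr (diag_mx _).
by apply/rowP => i; rewrite !mxE.
Qed.

Lemma lift_subD X Y : lift_sub (X + Y) = lift_sub X + lift_sub Y.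
Proof. by apply/matrixP => i j; rewrite !mxE mulrnDl. Qed.

Lemma lift_subZ a X : lift_sub (a *: X) = a *: lift_sub X.
Proof. by apply/matrixP => i j; rewrite !mxE mulrnAr. Qed.

Lemma lift_sub0 : lift_sub 0 = 0.
Proof. by apply/matrixP => i j; rewrite !mxE mul0rn. Qed.

Lemma lift_sub_congr (K X : 'M[C]_m) :
  lift_sub (K *m X *m K^t*) = lift_sub K *m lift_sub X *m (lift_sub K)^t*.
Proof. by rewrite !lift_subM lift_sub_adj. Qed.

(** Padding and partial trace are adjoint for the trace pairing; positivity, supports and entropies
    of marginals are all obtained through this duality. *)
Lemma mxtrace_lift_sub (A : 'M[C]_n) X : \tr (A *m lift_sub X) = \tr (ptrace_sub A *m X).
Proof.
rewrite /mxtrace sum_sub; apply: eq_bigr => x _; rewrite mxE.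
under eq_bigr => c _ do rewrite mxE sum_sub.
rewrite exchange_big; apply: eq_bigr => y _ /=; rewrite mxE mulr_suml.
apply: eq_bigr => c _; rewrite (bigD1 c) //= !mxE !sub_inK !sub_outK eqxx mulr1n.
by rewrite big1 ?addr0 // => d /negPf dc; rewrite !mxE !sub_outK dc mulr0n mulr0.
Qed.

Lemma mxtrace_ptrace_sub (A : 'M[C]_n) : \tr (ptrace_sub A) = \tr A.
Proof. by rewrite -[ptrace_sub A]mulmx1 -mxtrace_lift_sub lift_sub1 mulmx1. Qed.

Lemma mxtrace_lift (X : 'M[C]_m) : \tr (lift_sub X) = k%:R * \tr X.
Proof.
rewrite -[lift_sub X]mul1mx mxtrace_lift_sub.
have -> : ptrace_sub 1%:M = k%:R%:M.
  apply/matrixP => x y; rewrite !mxE.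
  under eq_bigr => c _ do rewrite mxE.
  rewrite (eq_bigr (fun=> (x == y)%:R)); first by rewrite sumr_const card_ord; case: (x == y); rewrite ?mulr1n ?mulr0n ?mul0rn.
  move=> c _; congr (_%:R); congr nat_of_bool; apply/eqP/eqP => [h|->//].
  by rewrite -(sub_inK e x c) h sub_inK.
by rewrite mul_scalar_mx mxtraceZ.
Qed.

Lemma lift_sub_normal X : X \is normalmx -> lift_sub X \is normalmx.
Proof. by move=> /normalmxP h; apply/normalmxP; rewrite -lift_sub_adj -!lift_subM h. Qed.

(** The padded eigenbasis diagonalizes the padded matrix, and [fcalc_diag] allows any eigenbasis. *)
Lemma lift_sub_fcalc f X : X \is normalmx -> fcalc f (lift_sub X) = lift_sub (fcalc f X).
Proof.
move=> nX; have [UU _] := unitarymxK (spectral_unitarymx X).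
have Uu : lift_sub (spectralmx X) \is unitarymx.
  by apply/unitarymxP; rewrite -lift_sub_adj -lift_subM UU lift_sub1.
rewrite (fcalc_diag f Uu (d := \row_i spectral_diag X 0 (sub_in e i))); last first.
  by rewrite -lift_sub_diag -lift_sub_adj -!lift_subM -normalmx_spectral.
rewrite /fcalc !lift_subM lift_sub_adj lift_sub_diag.
by congr (_ *m diag_mx _ *m _); apply/rowP => i; rewrite !mxE.
Qed.

Lemma lift_sub_psd X : psd X -> psd (lift_sub X).
Proof.
move=> X0; rewrite -(rootmxK X0) -{2}(rootmx_adj X0) lift_subM lift_sub_adj.
exact: psd_gram.
Qed.

(** By duality the quadratic form at v is the pairing of A with the padded rank-one matrix of v. *)
Lemma ptrace_sub_psd A : psd A -> psd (ptrace_sub A).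
Proof.
move=> A0 v.
have -> : (v^t* *m ptrace_sub A *m v) 0 0 = \tr (A *m lift_sub (v *m v^t*)).
  by rewrite mxtrace_lift_sub mulmxA mxtrace_mulC mulmxA /mxtrace big_ord1.
by apply: mxtrace_mul_psd => //; apply/lift_sub_psd/psd_gram.
Qed.

Definition kermx_proj p (A : 'M[C]_p) := fcalc (fun x => 1 - supp x) A.

Lemma suppmxD_kermx p (A : 'M[C]_p) : suppmx A + kermx_proj A = 1%:M.
Proof. by rewrite fcalcD -(fcalc1 A); apply: eq_fcalc => i; rewrite addrC subrK. Qed.

Lemma kermx_proj_adj p (A : 'M[C]_p) : (kermx_proj A)^t* = kermx_proj A.
Proof.
rewrite fcalc_adj; apply: eq_fcalc => i; apply/CrealP.
by rewrite rpredB ?supp_real ?real1.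
Qed.

Lemma mul_kermx_proj p (A : 'M[C]_p) : psd A -> A *m kermx_proj A = 0.
Proof.
move=> A0; rewrite -[X in X *m _](fcalc_id_psd A0) fcalcM.
rewrite -[RHS](scale0r (fcalc (fun=> 1) A)) fcalcZ.
apply: eq_fcalc => i; rewrite /supp mul0r.
by have [->|_] := eqVneq; rewrite ?mul0r // subrr mulr0.
Qed.

(** By duality A gives weight zero to the padded kernel projection of its marginal, and a positive A
    of weight zero on a projection annihilates it. Hence the support of A lies in that of the padded
    marginal. *)
Lemma mul_lift_kermx (A : 'M[C]_n) : psd A -> A *m lift_sub (kermx_proj (ptrace_sub A)) = 0.
Proof.
move=> A0; apply: mul_eq0_psd => //.
rewrite mxtrace_mulC -lift_sub_adj kermx_proj_adj mulmxA -lift_subM mxtrace_mulC.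
rewrite mxtrace_lift_sub mulmxA mul_kermx_proj ?mul0mx ?mxtrace0 //.
exact: ptrace_sub_psd.
Qed.

Lemma mul_lift_supp (A : 'M[C]_n) : psd A -> A *m lift_sub (suppmx (ptrace_sub A)) = A.
Proof.
move=> A0; rewrite -[RHS]mulmx1 -lift_sub1 -(suppmxD_kermx (ptrace_sub A)) lift_subD.
by rewrite mulmxDr mul_lift_kermx // addr0.
Qed.

End OneSubsystem.

(** * Concrete factorizations and maps acting on one tensor factor *)

Lemma unindex_fstK a b (x : 'I_a) (y : 'I_b) : (mxtens_unindex (mxtens_index (x, y))).1 = x.
Proof. by rewrite mxtens_indexK. Qed.

Lemma unindex_sndK a b (x : 'I_a) (y : 'I_b) : (mxtens_unindex (mxtens_index (x, y))).2 = y.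
Proof. by rewrite mxtens_indexK. Qed.

Lemma unindex_pairK a b (i : 'I_(a * b)) :
  mxtens_index ((mxtens_unindex i).1, (mxtens_unindex i).2) = i.
Proof. by rewrite -surjective_pairing mxtens_unindexK. Qed.

Definition fst_sub a b : subsystem (a * b) a b :=
  @Subsystem (a * b) a b (fun i => (mxtens_unindex i).1) (fun i => (mxtens_unindex i).2)
    (fun x y => mxtens_index (x, y)) (@unindex_fstK a b) (@unindex_sndK a b)
    (@unindex_pairK a b).

Definition snd_sub a b : subsystem (a * b) b a :=
  @Subsystem (a * b) b a (fun i => (mxtens_unindex i).2) (fun i => (mxtens_unindex i).1)
    (fun y x => mxtens_index (x, y)) (fun y x => unindex_sndK x y)
    (fun y x => unindex_fstK x y) (@unindex_pairK a b).

Section Assoc.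
Variables a b c : nat.

Definition assoc_in (i : 'I_(a * (b * c))) : 'I_(a * b) :=
  mxtens_index ((mxtens_unindex i).1, (mxtens_unindex (mxtens_unindex i).2).1).

Definition assoc_out (i : 'I_(a * (b * c))) : 'I_c :=
  (mxtens_unindex (mxtens_unindex i).2).2.

Definition assoc_pair (x : 'I_(a * b)) (z : 'I_c) : 'I_(a * (b * c)) :=
  mxtens_index ((mxtens_unindex x).1, mxtens_index ((mxtens_unindex x).2, z)).

Lemma assoc_inK x z : assoc_in (assoc_pair x z) = x.
Proof. by rewrite /assoc_in /assoc_pair unindex_sndK !unindex_fstK unindex_pairK. Qed.

Lemma assoc_outK x z : assoc_out (assoc_pair x z) = z.
Proof. by rewrite /assoc_out /assoc_pair !unindex_sndK. Qed.

Lemma assoc_pairK i : assoc_pair (assoc_in i) (assoc_out i) = i.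
Proof. by rewrite /assoc_in /assoc_out /assoc_pair unindex_fstK unindex_sndK !unindex_pairK. Qed.

Definition assoc_sub : subsystem (a * (b * c)) (a * b) c :=
  Subsystem assoc_inK assoc_outK assoc_pairK.

End Assoc.

Definition unindexE := (unindex_fstK, unindex_sndK).

Lemma fst_subE a b : (sub_in (fst_sub a b) = fun i => (mxtens_unindex i).1) *
  (sub_out (fst_sub a b) = fun i => (mxtens_unindex i).2) *
  (sub_pair (fst_sub a b) = fun x y => mxtens_index (x, y)).
Proof. by []. Qed.

Lemma snd_subE a b : (sub_in (snd_sub a b) = fun i => (mxtens_unindex i).2) *
  (sub_out (snd_sub a b) = fun i => (mxtens_unindex i).1) *
  (sub_pair (snd_sub a b) = fun y x => mxtens_index (x, y)).
Proof. by []. Qed.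

Lemma assoc_subE a b c : (sub_in (assoc_sub a b c) = @assoc_in a b c) *
  (sub_out (assoc_sub a b c) = @assoc_out a b c) *
  (sub_pair (assoc_sub a b c) = @assoc_pair a b c).
Proof. by []. Qed.

Definition subE := (fst_subE, snd_subE, assoc_subE).

Lemma lift_sub_assoc a b c (X : 'M[C]_b) :
  lift_sub (assoc_sub a b c) (lift_sub (snd_sub a b) X) =
  lift_sub (snd_sub a (b * c)) (lift_sub (fst_sub b c) X).
Proof.
apply/matrixP => i j; rewrite !mxE !subE /assoc_in /assoc_out !unindexE.
by rewrite mulrnAC.
Qed.

Lemma ptrace_sub_assoc a b c (X : 'M[C]_(a * (b * c))) :
  ptrace_sub (snd_sub a b) (ptrace_sub (assoc_sub a b c) X) =
  ptrace_sub (fst_sub b c) (ptrace_sub (snd_sub a (b * c)) X).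
Proof.
apply/matrixP => x y; rewrite !mxE.
under eq_bigr => i _ do rewrite mxE !subE /assoc_pair !unindexE.
by under [RHS]eq_bigr => i _ do rewrite mxE !subE; rewrite exchange_big.
Qed.

(** Same body as [id_tens], for a bare function, so that composites can be formed without a bundled
    linear structure. *)
Definition id_tensor k n p (F : 'M[C]_n -> 'M[C]_p) (X : 'M[C]_(k * n)) : 'M[C]_(k * p) :=
  \matrix_(s, t)
    F (\matrix_(j, j') X (mxtens_index ((mxtens_unindex s).1, j))
                         (mxtens_index ((mxtens_unindex t).1, j')))
      (mxtens_unindex s).2 (mxtens_unindex t).2.

Lemma id_tensor_comp k n p q (F : 'M[C]_n -> 'M[C]_p) (G : 'M[C]_p -> 'M[C]_q)
    (X : 'M[C]_(k * n)) : id_tensor (G \o F) X = id_tensor G (id_tensor F X).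
Proof.
apply/matrixP => s t; rewrite !mxE /comp; congr (G _ _ _).
by apply/matrixP => j j'; rewrite !mxE !unindexE.
Qed.

Lemma id_tensor_congr k n (K : 'M[C]_n) (X : 'M[C]_(k * n)) :
  id_tensor (fun Y => K *m Y *m K^t*) X =
  lift_sub (snd_sub k n) K *m X *m (lift_sub (snd_sub k n) K)^t*.
Proof.
rewrite -lift_sub_adj; apply/matrixP => s t; rewrite !mxE (sum_sub (snd_sub k n)).
apply: eq_bigr => y _; rewrite (bigD1 (mxtens_unindex t).1) //[X in _ = _ + X]big1 ?addr0; last first.
  by move=> x /negPf xt; rewrite [lift_sub _ _ _ _]mxE !subE !unindexE xt mulr0n mulr0.
rewrite [lift_sub _ _ _ _]mxE !subE !unindexE eqxx mulr1n; congr (_ * _).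
rewrite !mxE (sum_sub (snd_sub k n)); apply: eq_bigr => z _.
rewrite (bigD1 (mxtens_unindex s).1) //big1 ?addr0; last first.
  by move=> x /negPf xt; rewrite [lift_sub _ _ _ _]mxE !subE !unindexE eq_sym xt mulr0n mul0r.
rewrite !mxE !subE !unindexE eqxx mulr1n; exact: esym (addr0 _).
Qed.

Lemma id_tensor_fst a b c (X : 'M[C]_(a * b)) :
  id_tensor (lift_sub (fst_sub b c)) X = lift_sub (assoc_sub a b c) X.
Proof. by apply/matrixP => s t; rewrite !mxE. Qed.

Lemma id_tensorD k n p (F G : 'M[C]_n -> 'M[C]_p) (X : 'M[C]_(k * n)) :
  id_tensor (fun Y => F Y + G Y) X = id_tensor F X + id_tensor G X.
Proof. by apply/matrixP => s t; rewrite !mxE. Qed.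

Lemma id_tensorZ k n p a (F : 'M[C]_n -> 'M[C]_p) (X : 'M[C]_(k * n)) :
  id_tensor (fun Y => a *: F Y) X = a *: id_tensor F X.
Proof. by apply/matrixP => s t; rewrite !mxE. Qed.

Lemma mxtrace_mul_congr n p (A : 'M[C]_p) (K : 'M[C]_(p, n)) (X : 'M[C]_n) :
  \tr (A *m (K *m X *m K^t*)) = \tr (K^t* *m A *m K *m X).
Proof. by rewrite !mulmxA mxtrace_mulC !mulmxA. Qed.

(** * The rotated Petz recovery map *)

Section Petz.
Variables (b c : nat) (sigma : 'M[C]_(b * c)) (f g : C -> C).
Local Notation sigmaB := (ptrace_sub (fst_sub b c) sigma).

(* The last term makes the map trace preserving outside of the support of the marginal. *)
Definition petz (X : 'M[C]_b) : 'M[C]_(b * c) :=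
  fcalc f sigma *m lift_sub (fst_sub b c) (fcalc g sigmaB *m X *m (fcalc g sigmaB)^t*)
    *m (fcalc f sigma)^t*
  + c%:R^-1 *: lift_sub (fst_sub b c) (kermx_proj sigmaB *m X *m (kermx_proj sigmaB)^t*).

Lemma petz_is_linear : linear petz.
Proof.
move=> a X Y; rewrite /petz.
rewrite !mulmxDr !mulmxDl !lift_subD -!scalemxAr -!scalemxAl !lift_subZ.
rewrite !mulmxDr !mulmxDl -!scalemxAr -!scalemxAl !scalerDr !scalerA.
by rewrite [c%:R^-1 * a]mulrC addrACA.
Qed.

HB.instance Definition _ := GRing.isLinear.Build C _ _ _ petz petz_is_linear.

Lemma id_tensor_petz a (X : 'M[C]_(a * b)) : id_tensor petz X =
  lift_sub (snd_sub a (b * c)) (fcalc f sigma) *m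
    lift_sub (assoc_sub a b c) (lift_sub (snd_sub a b) (fcalc g sigmaB) *m X *m
       (lift_sub (snd_sub a b) (fcalc g sigmaB))^t*) *m
    (lift_sub (snd_sub a (b * c)) (fcalc f sigma))^t*
  + c%:R^-1 *: lift_sub (assoc_sub a b c) (lift_sub (snd_sub a b) (kermx_proj sigmaB) *m X *m
       (lift_sub (snd_sub a b) (kermx_proj sigmaB))^t*).
Proof.
pose ad p (K Y : 'M[C]_p) := K *m Y *m K^t*.
pose L := @lift_sub (b * c) b c (fst_sub b c).
transitivity (id_tensor (ad _ (fcalc f sigma) \o (L \o ad _ (fcalc g sigmaB))) X
  + id_tensor (fun Y => c%:R^-1 *: (L \o ad _ (kermx_proj sigmaB)) Y) X).
  by rewrite -id_tensorD.
rewrite (id_tensorZ _ (L \o _)) !id_tensor_comp.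
by rewrite !(id_tensor_congr _) !id_tensor_fst.
Qed.

Lemma petz_cp a (X : 'M[C]_(a * b)) : psd X -> psd (id_tensor petz X).
Proof.
move=> X0; rewrite id_tensor_petz; apply: psdD.
  by apply/psd_congr/lift_sub_psd/psd_congr.
by apply: psdZ; rewrite ?invr_ge0 ?ler0n //; apply/lift_sub_psd/psd_congr.
Qed.

Hypotheses (sigma0 : psd sigma) (c0 : (0 < c)%N).
(** Away from 0, [f] and [g] are a square root and an inverse square root up to an arbitrary phase;
    the phases are the rotation. *)
Hypothesis f2 : forall x, 0 <= x -> (f x)^* * f x = x.
Hypothesis g2 : forall x, 0 <= x -> (g x)^* * x * g x = supp x.

(** In the main term the two factors [f] recombine into sigma, whose marginal is cancelled by the
    two factors [g] up to the support projection. The correction term contributes the trace on the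
    complementary kernel, [c%:R^-1] compensating for the trace of the padding. *)
Lemma petz_tp (X : 'M[C]_b) : \tr (petz X) = \tr X.
Proof.
have s0 : psd sigmaB by exact: ptrace_sub_psd.
rewrite /petz raddfD /= mxtraceZ mxtrace_lift mulrA mulVf ?mul1r; last by rewrite pnatr_eq0 -lt0n.
have -> : \tr X = \tr (suppmx sigmaB *m X) + \tr (kermx_proj sigmaB *m X).
  by rewrite -raddfD -mulmxDl suppmxD_kermx mul1mx.
congr (_ + _); last first.
  rewrite mxtrace_mulC mulmxA kermx_proj_adj {1 2}/kermx_proj fcalcM; congr (\tr (_ *m _)).
  apply: eq_fcalc => i; rewrite /supp; case: (_ != 0).
    by rewrite subrr mulr0.
  by rewrite subr0 mulr1.
rewrite mxtrace_mulC mulmxA.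
have -> : (fcalc f sigma)^t* *m fcalc f sigma = sigma.
  by rewrite fcalc_adj fcalcM -[RHS]fcalc_id_psd //; apply: eq_fcalc_psd.
rewrite mxtrace_lift_sub mxtrace_mul_congr fcalc_adj fcalc_sandwich //.
by congr (\tr (_ *m _)); apply: eq_fcalc_psd.
Qed.

End Petz.

(** The correction term disappears because the kernel of the B marginal annihilates the A B
    marginal. *)
Lemma id_tensor_petz_marginal a b c (rho : 'M[C]_(a * (b * c))) f g : psd rho ->
  let sigma := ptrace_sub (snd_sub a (b * c)) rho in
  let sigmaB := ptrace_sub (fst_sub b c) sigma in
  let rhoAB := ptrace_sub (assoc_sub a b c) rho in
  let M := lift_sub (snd_sub a (b * c)) (fcalc f sigma) *m
    lift_sub (snd_sub a (b * c)) (lift_sub (fst_sub b c) (fcalc g sigmaB)) in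
  id_tensor (petz sigma f g) rhoAB = M *m lift_sub (assoc_sub a b c) rhoAB *m M^t*.
Proof.
move=> rho0 sigma sigmaB rhoAB M; rewrite id_tensor_petz -/sigmaB.
have sE : ptrace_sub (snd_sub a b) rhoAB = sigmaB by exact: ptrace_sub_assoc.
have AB0 : psd rhoAB by exact: ptrace_sub_psd.
have ker0 : rhoAB *m (lift_sub (snd_sub a b) (kermx_proj sigmaB))^t* = 0.
  by rewrite -lift_sub_adj kermx_proj_adj -sE; exact: mul_lift_kermx.
move: (kermx_proj sigmaB) ker0 => Q ker0.
rewrite -(mulmxA (lift_sub _ Q)) ker0 mulmx0 lift_sub0 scaler0 addr0.
rewrite lift_sub_congr /M -lift_sub_assoc.
move: (lift_sub _ (lift_sub _ (fcalc g _))) (lift_sub _ (fcalc f _)) (lift_sub _ rhoAB).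
by move=> {}M S Z; rewrite adjmxM !mulmxA.
Qed.

End Subsystems.

Local Open Scope classical_set_scope.
Local Open Scope sesquilinear_scope.
Local Open Scope complex_scope.

(** * Exponential sums on a strip *)

Section ExponentialSums.
Import numFieldNormedType.Exports.
Variable R : realType.
Local Notation C := R[i].

Lemma derive_first_order (f : R -> R) (df : R) : is_derive (0 : R) (1 : R) f df ->
  forall e : R, 0 < e -> exists2 r : R, 0 < r &
    forall h, `|h| < r -> `|f h - f 0 - h * df| <= e * `|h|.
Proof.
move=> fdf e e0.
have E : (fun h : R => h^-1 *: ((f \o shift (0 : R)) (h *: (1 : R)) - f 0)) =
    (fun h : R => h^-1 *: (f h - f 0)).
  by apply/funext => h; rewrite /= addr0 -[h *: 1]/(h * 1) mulr1.
have /cvgrPdist_le/(_ e e0) : h^-1 *: (f h - f 0) @[h --> (0 : R)^'] --> df.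
  have := @ex_derive _ _ _ _ _ _ _ fdf; rewrite /derivable E => hc.
  by rewrite -(@derive_val _ _ _ _ _ _ _ fdf) /derive E.
rewrite /dnbhs /within /= => /nbhs_ballP[r r0 hr]; exists r => // h hlt.
have [->|h0] := eqVneq h 0; first by rewrite !mul0r !subr0 subrr normr0 mulr0.
have := hr h; rewrite /ball /= sub0r normrN => /(_ hlt h0) hh.
have -> : f h - f 0 - h * df = - (h * (df - h^-1 *: (f h - f 0))).
  rewrite mulrBr -[_ *: _]/(_ * _) mulrA divff // mul1r; ring.
by rewrite normrN normrM mulrC ler_wpM2r.
Qed.

Lemma is_derive_expR0 : is_derive (0 : R) (1 : R) expR 1.
Proof. by have := is_derive_expR (0 : R); rewrite expR0. Qed.
Lemma is_derive_sin0 : is_derive (0 : R) (1 : R) sin 1.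
Proof. by have := is_derive_sin (0 : R); rewrite cos0. Qed.

(* cosh s + cos s - 2 = 2 (sinh^2 (s/2) - sin^2 (s/2)), and sinh and sin have the same tangent at 0. *)
Lemma cosh_cos_second_order (e : R) : 0 < e -> exists2 r : R, 0 < r &
  forall s, `|s| < r -> `|expR s + expR (- s) + 2 * cos s - 4| <= e * s ^+ 2.
Proof.
move=> e0.
(* The final estimate is 4 d (4 + 4 d) <= 32 d <= 4 e, using d <= 1, against s^2 = 4 t^2. *)
pose d : R := Num.min (e / 8) 1.
have d0 : 0 < d by rewrite lt_min ltr01 divr_gt0.
have d1 : d <= 1 by rewrite ge_min lexx orbT.
have d2 : d <= e / 8 by rewrite ge_min lexx.
have [r1 r10 H1] := derive_first_order is_derive_expR0 d0.
have [r2 r20 H2] := derive_first_order is_derive_sin0 d0.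
exists (Num.min r1 r2); first by rewrite lt_min r10.
move=> s; rewrite lt_min => /andP[s1 s2].
pose t := s / 2.
have tE : s = t + t by rewrite /t; lra.
have absE : `|t| = `|s| / 2 by rewrite normrM normfV [`|2|]ger0_norm.
have t1 : `|t| < r1 by rewrite absE; have := normr_ge0 s; lra.
have t2 : `|t| < r2 by rewrite absE; have := normr_ge0 s; lra.
have h1 := H1 t t1; have h1' := H1 (- t); rewrite normrN in h1'; have {}h1' := h1' t1.
have h2 := H2 t t2.
clearbody t; rewrite expR0 !mulr1 ler_norml in h1.
rewrite expR0 !mulr1 ler_norml in h1'.
rewrite sin0 !mulr1 subr0 ler_norml in h2; rewrite opprK in h1'.
case/andP: h1 => a1 a2; case/andP: h1' => b1 b2; case/andP: h2 => c1 c2.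
have E : expR s + expR (- s) + 2 * cos s - 4 =
   (expR t - expR (- t)) ^+ 2 - 4 * sin t ^+ 2.
  rewrite tE opprD !expRD cosD -!expr2 cos2sin2.
  have := expRxMexpNx_1 t; move: (expR t) (expR (-t)) (sin t) => p q w pq.
  have -> : (p - q) ^+ 2 = p ^+ 2 + q ^+ 2 - 2 * (p * q) by ring.
  rewrite pq; ring.
rewrite E.
set A := expR t - expR (- t) in E *; set S := sin t in c1 c2 E *.
have -> : A ^+ 2 - 4 * S ^+ 2 = (A - 2 * S) * (A + 2 * S) by ring.
have -> : s ^+ 2 = 4 * `|t| ^+ 2 by rewrite tE real_normK ?num_real //; ring.
have l0 : `|A - 2 * S| <= 4 * d * `|t|.
  by rewrite ler_norml /A; apply/andP; split; lra.
have l1 : `|A + 2 * S| <= (4 + 4 * d) * `|t|.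
  have := ler_norm t; have := ler_norm (- t); rewrite normrN.
  by rewrite ler_norml /A => ? ?; apply/andP; split; lra.
rewrite normrM; apply: le_trans (ler_pM _ _ l0 l1) _; rewrite ?normr_ge0 //.
have -> : 4 * d * `|t| * ((4 + 4 * d) * `|t|) = (4 * d * (4 + 4 * d)) * `|t| ^+ 2 by ring.
rewrite [e * _]mulrA; apply: ler_wpM2r; first exact: sqr_ge0.
have : d * d <= d by rewrite ler_piMr // ltW.
lra.
Qed.

(* Discrete maximum principle on the grids of mesh 1 / (m n). *)
Lemma strip_maximum (u : R -> R -> R) (L : nat) (r : R) : 0 < r ->
  (forall y, u 0 y <= 1) -> (forall y, u 1 y <= 1) ->
  (forall x y, 0 <= x <= 1 -> `|y| = L%:R -> u x y <= 1) ->
  (forall h x y, 0 < h < r -> 0 <= x <= 1 -> `|y| <= L%:R ->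
     4 * u x y < u (x + h) y + u (x - h) y + u x (y + h) + u x (y - h)) ->
  forall j m, (0 < m)%N -> (j <= m)%N -> u (j%:R / m%:R) 0 <= 1.
Proof.
move=> r0 u0 u1 uL usub j m m0 jm.
have [n n0 nr] : exists2 n, (0 < n)%N & n%:R^-1 < r.
  exists (Num.truncn r^-1).+1 => //.
  by rewrite invf_plt ?posrE ?ltr0n // truncnS_gt.
(* The factor [m] puts the abscissa j / m on the grid, as its point of index j n; the factor [n]
   makes the mesh smaller than [r]. *)
pose N := (m * n)%N; have N0 : (0 < N)%N by rewrite muln_gt0 m0.
have Nr0 : 0 < N%:R :> R by rewrite ltr0n.
pose h : R := N%:R^-1.
have h0 : 0 < h by rewrite invr_gt0.
have hN : N%:R * h = 1 by rewrite mulfV ?gt_eqF.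
have hr : h < r.
  apply: le_lt_trans nr; rewrite lef_pV2 ?posrE ?ltr0n //.
  by rewrite ler_nat leq_pmull.
(* Ordinates are [k - K] steps with k <= 2 K, so that the axis y = 0 and both edges of height L are
   grid lines. *)
pose K := (L * N)%N.
have KhL : K%:R * h = L%:R by rewrite natrM -mulrA hN mulr1.
pose F (p : 'I_N.+1 * 'I_(2 * K).+1) := u (p.1%:R * h) ((p.2%:R - K%:R) * h).
have jN : (j * n < N.+1)%N by rewrite ltnS leq_mul2r jm orbT.
have K2 : (K < (2 * K).+1)%N by rewrite ltnS leq_pmull.
pose p0 := (Ordinal jN, Ordinal K2).
have F0 : F p0 = u (j%:R / m%:R) 0.
  rewrite /F /= subrr mul0r; congr (u _ _).
  rewrite natrM /h /N natrM invfM -mulrA [n%:R * _]mulrC -!mulrA mulVf ?mulr1 //.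
  by rewrite pnatr_eq0 -lt0n.
rewrite -F0.
(* A grid maximum above 1 lies off the boundary, where it would be strictly less than the mean of
   four neighbours, none of which exceeds it. *)
case: (@Order.TotalTheory.arg_maxP _ _ _ p0 xpredT F) => // -[i k] _ hmax.
rewrite leNgt; apply/negP => /lt_le_trans/(_ (hmax p0 isT)) F1.
set x : R := i%:R * h; set y : R := (k%:R - K%:R) * h.
have x01 : 0 <= x <= 1.
  apply/andP; split; first by rewrite mulr_ge0 ?ler0n ?(ltW h0).
  by rewrite -[leRHS]hN ler_wpM2r ?(ltW h0) // ler_nat -ltnS.
have ki : (k <= 2 * K)%N by rewrite -ltnS ltn_ord.
have yE : `|y| <= L%:R.
  rewrite -KhL /y normrM (gtr0_norm h0) ler_wpM2r ?(ltW h0) // ler_norml.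
  move: ki; rewrite -(ler_nat R) natrM => ki; have := ler0n R k.
  by move=> ?; apply/andP; split; lra.
have i0 : (0 < i)%N.
  rewrite lt0n; apply/negP => /eqP i0; move: F1; rewrite ltNge /F /= i0 mul0r.
  by rewrite u0.
have iN : (i < N)%N.
  rewrite ltn_neqAle -ltnS ltn_ord andbT; apply/negP => /eqP iN.
  by move: F1; rewrite ltNge /F /= iN hN u1.
have k0 : (0 < k)%N.
  rewrite lt0n; apply/negP => /eqP k0; move: F1; rewrite ltNge /F /= uL //.
  by rewrite k0 sub0r mulNr normrN KhL ger0_norm.
have kK : (k < 2 * K)%N.
  rewrite ltn_neqAle ki andbT; apply/negP => /eqP kK; move: F1.
  rewrite ltNge /F /= uL // kK natrM.
  have -> : (2 * K%:R - K%:R) * h = K%:R * h by ring.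
  by rewrite KhL ger0_norm.
have := usub h x y; rewrite h0 hr => /(_ isT x01 yE).
have i1 : (i.+1 < N.+1)%N by [].
have i2 : (i.-1 < N.+1)%N by apply: leq_ltn_trans (leq_pred i) (ltn_ord i).
have k1 : (k.+1 < (2 * K).+1)%N by [].
have k2 : (k.-1 < (2 * K).+1)%N by apply: leq_ltn_trans (leq_pred k) (ltn_ord k).
have predE (l : nat) : (0 < l)%N -> l.-1%:R = l%:R - 1 :> R.
  by move=> l0; rewrite -{2}(prednK l0) -natr1 addrK.
have := hmax (Ordinal i1, k) isT; have := hmax (Ordinal i2, k) isT.
have := hmax (i, Ordinal k1) isT; have := hmax (i, Ordinal k2) isT.
rewrite /F /= !predE // -!natr1.
have -> : (k%:R - 1 - K%:R) * h = y - h by rewrite /y; ring.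
have -> : (k%:R + 1 - K%:R) * h = y + h by rewrite /y; ring.
have -> : (i%:R - 1) * h = x - h by rewrite /x; ring.
have -> : (i%:R + 1) * h = x + h by rewrite /x; ring.
by rewrite -/x -/y => ? ? ? ? ?; lra.
Qed.

Definition cexp (x y : R) : C := (expR x * cos y) +i* (expR x * sin y).

Lemma cexpD x x' y y' : cexp (x + x') (y + y') = cexp x y * cexp x' y'.
Proof.
rewrite /cexp expRD cosD sinD; simpc.
by apply/eqP; rewrite eq_complex /=; apply/andP; split; apply/eqP; ring.
Qed.

Lemma cexp00 : cexp 0 0 = 1.
Proof. by rewrite /cexp expR0 cos0 sin0 mulr1 mulr0. Qed.

Lemma normc_cexp x y : `|cexp x y| = (expR x)%:C.
Proof.
rewrite normc_def /= !exprMn -mulrDr cos2Dsin2 mulr1 sqrtr_sqr ger0_norm //.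
exact: expR_ge0.
Qed.

Definition expsum (s : seq (C * R)) (x y : R) : C :=
  \sum_(p <- s) p.1 * cexp (p.2 * x) (p.2 * y).

Lemma Re_expsum_cons p s x y : complex.Re (expsum (p :: s) x y) =
  expR (p.2 * x) * (complex.Re p.1 * cos (p.2 * y) - complex.Im p.1 * sin (p.2 * y))
  + complex.Re (expsum s x y).
Proof.
rewrite /expsum big_cons; case: p => -[a b] l /=.
by case: (\sum_(_ <- _) _) => c d /=; ring.
Qed.

Lemma Re_expsum_nil x y : complex.Re (expsum [::] x y) = 0.
Proof. by rewrite /expsum big_nil. Qed.

Lemma Re_expsum_bound s : exists2 M : R, 0 <= M &
  forall x y, 0 <= x <= 1 -> `|complex.Re (expsum s x y)| <= M.
Proof.
elim: s => [|p s [M M0 HM]].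
  by exists 0 => // x y _; rewrite Re_expsum_nil normr0.
exists (expR `|p.2| * (`|complex.Re p.1| + `|complex.Im p.1|) + M).
  by rewrite addr_ge0 // mulr_ge0 ?expR_ge0 // addr_ge0.
move=> x y x01; rewrite Re_expsum_cons.
apply: le_trans (ler_normD _ _) _; apply: lerD; last exact: HM.
rewrite normrM ger0_norm ?expR_ge0 //; apply: ler_pM; rewrite ?expR_ge0 ?normr_ge0 //.
  rewrite ler_expR; case/andP: x01 => x0 x1; apply: le_trans (ler_norm _) _.
  by rewrite normrM ler_piMr // ger0_norm.
apply: le_trans (ler_normB _ _) _; rewrite !normrM.
by apply: lerD; rewrite ler_piMr // ?cos_max ?sin_max.
Qed.

(** The five-point Laplacian multiplies an exponential of rate a by the real number e^(a h) + e^(- a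
    h) + 2 cos (a h) - 4, which is o(h^2). This discrete remnant of harmonicity survives taking real
    parts and sums. *)
Lemma Re_expsum_laplacian s (e : R) : 0 < e -> exists2 r : R, 0 < r &
  forall h x y, 0 < h < r -> 0 <= x <= 1 ->
  let u x y := complex.Re (expsum s x y) in
  `|u (x + h) y + u (x - h) y + u x (y + h) + u x (y - h) - 4 * u x y| <= e * h ^+ 2.
Proof.
elim: s e => [|p s IH] e e0 /=.
  exists 1 => // h x y _ _; rewrite !Re_expsum_nil.
  by rewrite mulr0 subr0 !addr0 normr0 mulr_ge0 ?(ltW e0) ?sqr_ge0.
have e2 : 0 < e / 2 by lra.
have [r1 r10 H1] := IH _ e2.
have [M M0 HM] := Re_expsum_bound [:: p].
pose a := p.2.
(* Chosen so that M d (a h)^2 <= (e / 2) h^2; the added ones keep the denominator nonzero when M or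
   a vanishes. *)
have d0 : 0 < e / 2 / ((M + 1) * (a ^+ 2 + 1)).
  by rewrite divr_gt0 // mulr_gt0 // ltr_wpDl // sqr_ge0.
have [r2 r20 H2] := cosh_cos_second_order d0.
exists (Num.min r1 (r2 / (`|a| + 1))).
  by rewrite lt_min r10 divr_gt0 // ltr_wpDl.
move=> h x y /andP[h0]; rewrite lt_min => /andP[hr1 hr2] x01.
rewrite !Re_expsum_cons -/a.
have := H1 h x y; rewrite h0 hr1 => /(_ isT x01) /=.
have ahr : `|a * h| < r2.
  rewrite normrM (gtr0_norm h0).
  move: hr2; rewrite ltr_pdivlMr ?ltr_wpDl // mulrDr mulr1 => hr2.
  have : 0 < h * 1 by rewrite mulr1.
  by rewrite mulrC; lra.
have := H2 _ ahr.
have := HM x y x01; rewrite Re_expsum_cons Re_expsum_nil addr0 -/a.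
move: (complex.Re (expsum s (x + h) y)) (complex.Re (expsum s (x - h) y))
  (complex.Re (expsum s x (y + h))) (complex.Re (expsum s x (y - h)))
  (complex.Re (expsum s x y)) => A1 A2 A3 A4 A5.
rewrite !(mulrDr a) !(mulrN a) !cosB !cosD !sinB !sinD !expRD.
set E := expR (a * x); set c := cos (a * y); set w := sin (a * y).
set E1 := expR (a * h); set E2 := expR (- (a * h)).
set c' := cos (a * h); set w' := sin (a * h).
set p1 := complex.Re p.1; set p2 := complex.Im p.1.
move=> K1 K2 K3.
set Q := (Y in `|Y| <= _).
have -> : Q = E * (p1 * c - p2 * w) * (E1 + E2 + 2 * c' - 4) +
   (A1 + A2 + A3 + A4 - 4 * A5) by rewrite /Q; ring.
apply: le_trans (ler_normD _ _) _.
have -> : e * h ^+ 2 = e / 2 * h ^+ 2 + e / 2 * h ^+ 2 by lra.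
apply: lerD => //; rewrite normrM.
apply: le_trans (ler_pM (normr_ge0 _) (normr_ge0 _) K1 K2) _.
have -> : M * (e / 2 / ((M + 1) * (a ^+ 2 + 1)) * (a * h) ^+ 2) =
   (e / 2 * h ^+ 2) * ((M / (M + 1)) * (a ^+ 2 / (a ^+ 2 + 1))).
  rewrite exprMn invfM; ring.
apply: ler_piMr; first by apply: mulr_ge0; rewrite ?sqr_ge0 ?(ltW e2).
have a20 := sqr_ge0 a.
apply: mulr_ile1; rewrite ?divr_ge0 ?addr_ge0 //.
  by rewrite ler_pdivrMr ?mul1r; lra.
by rewrite ler_pdivrMr ?mul1r; lra.
Qed.

Lemma Re_expsum_le1 s : (forall y, complex.Re (expsum s 0 y) <= 1) ->
  (forall y, complex.Re (expsum s 1 y) <= 1) ->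
  forall j m, (0 < m)%N -> (j <= m)%N -> complex.Re (expsum s (j%:R / m%:R) 0) <= 1.
Proof.
move=> s0 s1 j m m0 jm.
set X := j%:R / m%:R.
have X01 : 0 <= X <= 1.
  by rewrite divr_ge0 ?ler0n //= ler_pdivrMr ?mul1r ?ler_nat // ltr0n.
apply/ler_addgt0Pr => e' e'0.
(* On the axis y = 0 the barrier costs at most 2 e, which is [e']. *)
pose e := e' / 2; have e0 : 0 < e by rewrite divr_gt0.
have [M M0 HM] := Re_expsum_bound s.
have [r r0 Hr] := Re_expsum_laplacian s e0.
(* At height L the term e L^2 of the barrier absorbs the uniform bound M. *)
pose L := (Num.truncn (M / e)).+1.
have LM : M <= e * L%:R ^+ 2.
  have h1 : M / e < L%:R by exact: truncnS_gt.
  have h2 : 1 <= L%:R :> R by rewrite ler1n.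
  rewrite -ler_pdivrMl // mulrC (le_trans (ltW h1)) // expr2.
  by rewrite ler_peMl // ler0n.
(* The barrier y^2 + 2 - 2 x^2 is nonnegative and strictly superharmonic on the strip and grows with y. *)
pose u x y := complex.Re (expsum s x y) - e * (y ^+ 2 + 2 - 2 * x ^+ 2).
have : u X 0 <= 1.
  apply: (@strip_maximum u L r r0 _ _ _ _ j m m0 jm).
  - move=> y; rewrite /u; have := s0 y; have := mulr_ge0 (ltW e0) (sqr_ge0 y).
    by rewrite expr0n /= mulr0 subr0 mulrDr; lra.
  - move=> y; rewrite /u; have := s1 y; have := mulr_ge0 (ltW e0) (sqr_ge0 y).
    rewrite expr1n mulr1 addrK; lra.
  - move=> x y x01 yL; rewrite /u.
    have := HM x y x01; rewrite ler_norml => /andP[_ h1].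
    have -> : y ^+ 2 = L%:R ^+ 2 by rewrite -yL real_normK ?num_real.
    have h2 : 0 <= e * (2 - 2 * x ^+ 2).
      rewrite mulr_ge0 ?(ltW e0) // subr_ge0 ler_piMr //.
      by case/andP: x01 => a b; rewrite expr_le1.
    rewrite -addrA mulrDr; lra.
  (* Subtracting the barrier adds exactly 2 e h^2 to the Laplacian, more than the defect e h^2
     allowed by [Hr]. *)
  - move=> h x y hr x01 _; have /= := Hr h x y hr x01; rewrite /u.
    rewrite ler_norml => /andP[h1 _].
    have : 0 < e * h ^+ 2 by case/andP: hr => h0 _; rewrite mulr_gt0 ?exprn_gt0.
    move: h1.
    move: (complex.Re (expsum s (x + h) y)) (complex.Re (expsum s (x - h) y))
      (complex.Re (expsum s x (y + h))) (complex.Re (expsum s x (y - h)))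
      (complex.Re (expsum s x y)) => A1 A2 A3 A4 A5 h1 h2.
    rewrite -subr_gt0.
    set Q := (Y in 0 < Y).
    have -> : Q = (A1 + A2 + A3 + A4 - 4 * A5) + 2 * (e * h ^+ 2) by rewrite /Q; ring.
    lra.
rewrite /u expr0n /= add0r => h1.
have h2 : 0 <= e * (2 * X ^+ 2) by rewrite pmulr_rge0 // mulr_ge0 ?sqr_ge0.
have eE : e' = e * 2 by rewrite /e; lra.
move: h1; rewrite eE mulrBr; lra.
Qed.

Lemma Re_expsum_first_order s (e : R) : 0 < e -> exists2 r : R, 0 < r &
  forall h, 0 < h < r ->
  `|complex.Re (expsum s h 0) - complex.Re (expsum s 0 0)
    - h * complex.Re (\sum_(p <- s) p.1 * p.2%:C)| <= e * h.
Proof.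
elim: s e => [|p s IH] e e0.
  exists 1 => // h /andP[h0 _]; rewrite !Re_expsum_nil big_nil /=.
  by rewrite mulr0 !subr0 normr0 mulr_ge0 // ltW.
have e2 : 0 < e / 2 by lra.
have [r1 r10 H1] := IH _ e2.
pose a := p.2; pose b := complex.Re p.1.
have d0 : 0 < e / 2 / ((`|b| + 1) * (`|a| + 1)).
  by rewrite divr_gt0 // mulr_gt0 // ltr_wpDl.
have [r2 r20 H2] := derive_first_order is_derive_expR0 d0.
exists (Num.min r1 (r2 / (`|a| + 1))).
  by rewrite lt_min r10 divr_gt0 // ltr_wpDl.
move=> h /andP[h0]; rewrite lt_min => /andP[hr1 hr2].
have ahr : `|a * h| < r2.
  rewrite normrM (gtr0_norm h0).
  move: hr2; rewrite ltr_pdivlMr ?ltr_wpDl // mulrDr mulr1 => hr2.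
  have : 0 < h * 1 by rewrite mulr1.
  by rewrite mulrC; lra.
have := H2 _ ahr; have := H1 h; rewrite h0 hr1 => /(_ isT).
rewrite !Re_expsum_cons -/a -/b big_cons.
have -> : complex.Re (p.1 * (p.2)%:C + \sum_(j <- s) j.1 * (j.2)%:C) =
   b * a + complex.Re (\sum_(j <- s) j.1 * (j.2)%:C).
  by rewrite /a /b; case: (p.1) => ? ?; case: (\sum_(_ <- _) _) => ? ? /=; ring.
rewrite !mulr0 !expR0 cos0 sin0 mulr0 subr0 !mulr1 mul1r.
move: (complex.Re (expsum s h 0)) (complex.Re (expsum s 0 0))
  (complex.Re (\sum_(j <- s) j.1 * (j.2)%:C)) => A1 A2 A3.
set E := expR _ => K1 K2.
have -> : E * b + A1 - (b + A2) - h * (b * a + A3) =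
   b * (E - 1 - a * h) + (A1 - A2 - h * A3) by ring.
apply: le_trans (ler_normD _ _) _.
have -> : e * h = e / 2 * h + e / 2 * h by lra.
apply: lerD => //; rewrite normrM.
apply: le_trans (ler_wpM2l (normr_ge0 _) K2) _.
rewrite normrM (gtr0_norm h0).
have -> : `|b| * (e / 2 / ((`|b| + 1) * (`|a| + 1)) * (`|a| * h)) =
   (e / 2 * h) * ((`|b| / (`|b| + 1)) * (`|a| / (`|a| + 1))).
  rewrite invfM; ring.
apply: ler_piMr; first by apply: mulr_ge0; rewrite ?(ltW h0) ?(ltW e2).
have := normr_ge0 a; have := normr_ge0 b => a0 b0.
apply: mulr_ile1; rewrite ?divr_ge0 ?addr_ge0 //.
  by rewrite ler_pdivrMr ?mul1r; lra.
by rewrite ler_pdivrMr ?mul1r; lra.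
Qed.

(** The value 1 at the origin is an upper bound at all points 1 / n, so the difference quotients
    there are nonpositive. *)
Lemma Re_expsum_slope s : (forall y, complex.Re (expsum s 0 y) <= 1) ->
  (forall y, complex.Re (expsum s 1 y) <= 1) -> complex.Re (expsum s 0 0) = 1 ->
  complex.Re (\sum_(p <- s) p.1 * p.2%:C) <= 0.
Proof.
move=> s0 s1 s00; apply/ler_addgt0Pr => e e0; rewrite add0r.
have [r r0 Hr] := Re_expsum_first_order s e0.
pose n := (Num.truncn r^-1).+1.
have n0 : 0 < n%:R :> R by rewrite ltr0n.
have nr : n%:R^-1 < r by rewrite invf_plt ?posrE // truncnS_gt.
have := Hr n%:R^-1; rewrite invr_gt0 n0 nr s00 => /(_ isT).
have /= := Re_expsum_le1 s0 s1 (ltn0Sn _) (leq_ltn_trans (leq0n _) (ltn0Sn _) : (1 <= n)%N).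
rewrite mul1r => h1; rewrite ler_norml => /andP[h2 _].
rewrite -(ler_pM2l (x := n%:R^-1)) ?invr_gt0 //.
lra.
Qed.

End ExponentialSums.

(** * Complex powers of matrices as exponential sums *)

Section ComplexPowers.
Variable R : realType.
Local Notation C := R[i].

(* The complex power l ^ (x + i y), with the convention 0 ^ z = 0. *)
Definition cpow (x y : R) (l : C) : C :=
  if l == 0 then 0 else cexp (x * ln (complex.Re l)) (y * ln (complex.Re l)).

Lemma cpowD x x' y y' l : cpow (x + x') (y + y') l = cpow x y l * cpow x' y' l.
Proof.
by rewrite /cpow; case: eqVneq => _; rewrite ?mul0r // !mulrDl cexpD.
Qed.

Lemma ge0_complexE (l : C) : 0 <= l -> l = (complex.Re l)%:C.
Proof. by move=> l0; rewrite RRe_real ?ger0_real. Qed.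

Lemma gt0_Re (l : C) : 0 <= l -> l != 0 -> 0 < complex.Re l.
Proof. by move=> l0 ln0; rewrite -ltcR -ge0_complexE // lt_def ln0. Qed.

Lemma cpow10 l : 0 <= l -> cpow 1 0 l = l.
Proof.
move=> l0; rewrite /cpow; case: eqVneq => [->//|ln0].
rewrite mul1r mul0r /cexp cos0 sin0 mulr1 mulr0 lnK ?posrE ?gt0_Re //.
by rewrite [RHS]ge0_complexE.
Qed.

Lemma cpow00 l : cpow 0 0 l = supp l.
Proof. by rewrite /cpow /supp; case: eqVneq => //= _; rewrite !mul0r cexp00. Qed.

Lemma cpow_conj x y l : (cpow x y l)^*%R = cpow x (- y) l.
Proof.
rewrite /cpow; case: eqVneq => _; first by rewrite rmorph0.
by rewrite /cexp mulNr cosN sinN mulrN.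
Qed.

Lemma normc_cpow0 y l : `|cpow 0 y l| <= 1.
Proof.
rewrite /cpow; case: eqVneq => _; first by rewrite normr0 ler01.
by rewrite normc_cexp mul0r expR0.
Qed.

Lemma cpow_half l : 0 <= l -> cpow 2^-1 0 l = sqrtC l.
Proof.
move=> l0; have p0 : 0 <= cpow 2^-1 0 l.
  rewrite /cpow; case: eqVneq => // _; rewrite mul0r /cexp cos0 sin0 mulr1 mulr0.
  by rewrite ler0c expR_ge0.
rewrite -[LHS]sqrCK // expr2 -cpowD addr0.
by rewrite (_ : 2^-1 + 2^-1 = 1) ?cpow10 //; lra.
Qed.

(** [d] is the complex derivative of [g] at 0, read off the exponents. Sums and products then obey
    the Leibniz rule by algebra alone. *)
Definition expform (g : R -> R -> C) (d : C) := exists s : seq (C * R),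
  (forall x y, g x y = expsum s x y) /\ \sum_(p <- s) p.1 * p.2%:C = d.

Lemma expform_ext g g' d d' : (forall x y, g x y = g' x y) -> d = d' ->
  expform g d -> expform g' d'.
Proof. by move=> gg <- [s [gs ds]]; exists s; split => // x y; rewrite -gg gs. Qed.

Lemma expform_cst c : expform (fun _ _ => c) 0.
Proof.
exists [:: (c, 0)]; split; last by rewrite big_seq1 mulr0.
by move=> x y; rewrite /expsum big_seq1 !mul0r cexp00 mulr1.
Qed.

Lemma expform_cexp a : expform (fun x y => cexp (a * x) (a * y)) a%:C.
Proof.
exists [:: (1, a)]; split; last by rewrite big_seq1 mul1r.
by move=> x y; rewrite /expsum big_seq1 mul1r.
Qed.

Lemma expform_add g g' d d' : expform g d -> expform g' d' ->
  expform (fun x y => g x y + g' x y) (d + d').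
Proof.
move=> [s [gs <-]] [s' [gs' <-]]; exists (s ++ s'); split; last by rewrite big_cat.
by move=> x y; rewrite gs gs' /expsum big_cat.
Qed.

Lemma expform_mul g g' d d' : expform g d -> expform g' d' ->
  expform (fun x y => g x y * g' x y) (d * g' 0 0 + g 0 0 * d').
Proof.
move=> [s [gs <-]] [s' [gs' <-]].
exists [seq (p.1 * q.1, p.2 + q.2) | p <- s, q <- s']; split.
  move=> x y; rewrite gs gs' /expsum big_allpairs_dep mulr_suml.
  apply: eq_bigr => p _; rewrite mulr_sumr; apply: eq_bigr => q _ /=.
  by rewrite !mulrDl cexpD; ring.
rewrite gs gs' /expsum big_allpairs_dep !mulr_suml -big_split.
apply: eq_bigr => p _; rewrite !mulr_sumr -big_split.
apply: eq_bigr => q _ /=; rewrite !mulr0 cexp00 rmorphD /=; ring.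
Qed.

Lemma expform_sum (I : finType) (g : I -> R -> R -> C) d : (forall i, expform (g i) (d i)) ->
  expform (fun x y => \sum_i g i x y) (\sum_i d i).
Proof.
move=> gd; rewrite -big_enum.
apply: (@expform_ext (fun x y => \sum_(i <- enum I) g i x y) _ _ _ _ erefl).
  by move=> x y; rewrite big_enum.
elim: (enum I) => [|i s IH].
  rewrite big_nil; apply: expform_ext (expform_cst 0) => // x y.
  by rewrite big_nil.
rewrite big_cons; apply: expform_ext (expform_add (gd i) IH) => // x y.
by rewrite big_cons.
Qed.

Lemma expform_cpow a l :
  expform (fun x y => cpow (a * x) (a * y) l) (a%:C * (ln (complex.Re l))%:C).
Proof.
rewrite /cpow; case: eqVneq => [->|_].
  (* The power of 0 is constantly 0, and [ln 0 = 0] gives it the matching derivative. *)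
  by apply: expform_ext (expform_cst 0) => //; rewrite /= ln0 // mulr0.
apply: expform_ext (expform_cexp (a * ln (complex.Re l))); last by rewrite rmorphM.
by move=> x y; congr cexp; ring.
Qed.

Definition mxexpform m n (G : R -> R -> 'M[C]_(m, n)) (D : 'M[C]_(m, n)) :=
  forall i j, expform (fun x y => G x y i j) (D i j).

Lemma mxexpform_cst m n (A : 'M[C]_(m, n)) : mxexpform (fun _ _ => A) 0.
Proof. by move=> i j; rewrite mxE; apply: expform_cst. Qed.

Lemma mxexpform_mul m n p (G : R -> R -> 'M[C]_(m, n)) (G' : R -> R -> 'M[C]_(n, p)) D D' :
  mxexpform G D -> mxexpform G' D' ->
  mxexpform (fun x y => G x y *m G' x y) (D *m G' 0 0 + G 0 0 *m D').
Proof.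
move=> GD GD' i j.
apply: expform_ext (expform_sum (fun k => expform_mul (GD i k) (GD' k j))).
  by move=> x y; rewrite mxE.
by rewrite !mxE -big_split.
Qed.

Lemma mxexpform_tr n (G : R -> R -> 'M[C]_n) D :
  mxexpform G D -> expform (fun x y => \tr (G x y)) (\tr D).
Proof. by move=> GD; apply: expform_sum. Qed.

Definition lnmx n (A : 'M[C]_n) : 'M[C]_n := fcalc (fun l => (ln (complex.Re l))%:C) A.

Lemma mxexpform_cpow n (A : 'M[C]_n) a :
  mxexpform (fun x y => fcalc (cpow (a * x) (a * y)) A) (a%:C *: lnmx A).
Proof.
have Ed : mxexpform (fun x y => diag_mx (map_mx (cpow (a * x) (a * y)) (spectral_diag A)))
    (diag_mx (map_mx (fun l => a%:C * (ln (complex.Re l))%:C) (spectral_diag A))).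
  move=> i j; rewrite !mxE.
  have [->|ij] := eqVneq i j.
    rewrite mulr1n.
    by apply: expform_ext (expform_cpow a (spectral_diag A 0 j)) => // x y; rewrite !mxE eqxx.
  rewrite mulr0n; apply: expform_ext (expform_cst 0) => // x y.
  by rewrite !mxE (negPf ij).
have := mxexpform_mul (mxexpform_mul (mxexpform_cst ((spectralmx A)^t*)) Ed)
  (mxexpform_cst (spectralmx A)).
rewrite mul0mx add0r mulmx0 addr0 => h i j.
by apply: expform_ext (h i j) => //; rewrite fcalcZ.
Qed.

Lemma Re_le_norm (z : C) (m : R) : `|z| <= m%:C -> complex.Re z <= m.
Proof.
move=> h; rewrite -lecR; apply: le_trans h; apply: le_trans (normc_ge_Re z).
by rewrite lecR ler_norm.
Qed.

End ComplexPowers.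

(** * The three-lines argument *)

Section Core.
Variable R : realType.
Local Notation C := R[i].

Lemma mul_cpow_half y (l : C) : 0 <= l -> l * cpow (- 2^-1) y l = cpow 0 y l * sqrtC l.
Proof.
have e : 1 + - 2^-1 = 2^-1 :> R by lra.
move=> l0; transitivity (cpow 1 0 l * cpow (- 2^-1) y l); first by rewrite cpow10.
rewrite -cpow_half // -!cpowD add0r add0r addr0.
by rewrite e.
Qed.

Section Generic.
Variables (K : numClosedFieldType) (n : nat) (rho : 'M[K]_n).
Hypotheses (rho0 : psd rho) (rho1 : \tr rho = 1).

(** This is the line Re z = 0. Splitting rho evenly around [a] leaves two factors, each a root of
    rho times contractions, hence of Hilbert-Schmidt norm at most 1. *)
Lemma trace_contractions_le1 (X Y Z : 'M[K]_n) (a f g h : K -> K) :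
  (forall l, `|a l| <= 1) -> (forall l, `|f l| <= 1) -> (forall l, `|g l| <= 1) ->
  (forall l, `|h l| <= 1) ->
  `|\tr (rho *m fcalc a rho *m fcalc f X *m fcalc g Y *m fcalc h Z)| <= 1.
Proof.
move=> a1 f1 g1 h1.
have rn : hsnorm2 (rootmx rho) = 1 by rewrite /hsnorm2 rootmx_adj // rootmxK.
have -> : rho *m fcalc a rho = rootmx rho *m fcalc a rho *m rootmx rho.
  rewrite -{1}(fcalc_id_psd rho0) !fcalcM; apply: eq_fcalc => i.
  by rewrite mulrAC -expr2 sqrtCK.
have assoc (A B D E F G : 'M[K]_n) :
    A *m B *m D *m E *m F *m G = (A *m B) *m (D *m E *m F *m G) by rewrite !mulmxA.
rewrite assoc; set P := _ *m fcalc a rho; set Q := _ *m fcalc h Z.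
have hP : hsnorm2 P <= 1 by rewrite -rn; apply: hsnorm2_contraction.
have hQ : hsnorm2 Q <= 1.
  rewrite /Q -rn; do 2![apply: le_trans (hsnorm2_contraction _ _) _ => //].
  exact: hsnorm2_contraction.
rewrite -(@ler_sqr _ `|_| 1) ?nnegrE // expr1n.
apply: le_trans (mxtrace_mul_CauchySchwarz P Q) _.
by apply: mulr_ile1; rewrite ?hsnorm2_ge0.
Qed.

(** This is the line Re z = 1. There rho times its power of real part - 1/2 is a contraction [b] of
    rho times its root, so the trace norm of the remaining product bounds the trace. *)
Lemma trace_half_le (X Y Z : 'M[K]_n) (a b f g h : K -> K) :
  (forall l, `|b l| <= 1) -> (forall l, 0 <= l -> l * a l = b l * sqrtC l) ->
  `|\tr (rho *m fcalc a rho *m fcalc f X *m fcalc g Y *m fcalc h Z)| <=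
  \tr (rootmx (rootmx rho *m (fcalc f X *m fcalc g Y *m fcalc h Z) *m
    (rootmx rho *m (fcalc f X *m fcalc g Y *m fcalc h Z))^t*)).
Proof.
move=> b1 ab.
have -> : rho *m fcalc a rho = fcalc b rho *m rootmx rho.
  rewrite -{1}(fcalc_id_psd rho0) !fcalcM; exact: eq_fcalc_psd rho0 ab.
have assoc (A B E F G : 'M[K]_n) : A *m B *m E *m F *m G = A *m (B *m (E *m F *m G)).
  by rewrite !mulmxA.
by rewrite assoc; apply: trace_norm_ge => i; exact: b1.
Qed.

(** The Leibniz rule leaves each logarithm followed by support projections; cyclicity brings them
    next to rho, which absorbs them. The first logarithm is moved across rho beforehand, as the two
    commute. *)
Lemma mxtrace_supp_derivative (L1 L2 L3 L4 P2 P3 P4 : 'M[K]_n) :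
  rho *m L1 = L1 *m rho ->
  rho *m P2 = rho -> P2 *m rho = rho -> rho *m P3 = rho -> P3 *m rho = rho ->
  rho *m P4 = rho -> P4 *m rho = rho ->
  \tr ((((rho *m L1 *m P2 + rho *m L2) *m P3 + rho *m L3) *m P4 + rho *m L4)) =
  \tr (rho *m L1) + \tr (rho *m L2) + \tr (rho *m L3) + \tr (rho *m L4).
Proof.
move=> c1 r2 l2 r3 l3 r4 l4.
have tr4 (A : 'M[K]_n) : \tr (rho *m A *m P4) = \tr (rho *m A).
  by rewrite mxtrace_mulC mulmxA l4.
have tr3 (A : 'M[K]_n) : \tr (rho *m A *m P3 *m P4) = \tr (rho *m A *m P3).
  by rewrite -(mulmxA rho) tr4 mulmxA.
have tr3' (A : 'M[K]_n) : \tr (rho *m A *m P3) = \tr (rho *m A).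
  by rewrite mxtrace_mulC mulmxA l3.
rewrite !mulmxDl !raddfD /= tr3 tr3' tr4 c1 -(mulmxA L1) r2 -(mulmxA L1) r3.
by rewrite -(mulmxA L1) r4.
Qed.

End Generic.

Lemma mxexpform_prod5 n (A : 'M[C]_n) (G1 G2 G3 G4 : R -> R -> 'M[C]_n) D1 D2 D3 D4 :
  mxexpform G1 D1 -> mxexpform G2 D2 -> mxexpform G3 D3 -> mxexpform G4 D4 ->
  mxexpform (fun x y => A *m G1 x y *m G2 x y *m G3 x y *m G4 x y)
   ((((A *m D1 *m G2 0 0 + A *m G1 0 0 *m D2) *m G3 0 0
      + A *m G1 0 0 *m G2 0 0 *m D3) *m G4 0 0
      + A *m G1 0 0 *m G2 0 0 *m G3 0 0 *m D4)).
Proof.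
move=> h1 h2 h3 h4.
have := mxexpform_mul (mxexpform_mul (mxexpform_mul (mxexpform_mul
    (mxexpform_cst A) h1) h2) h3) h4.
by rewrite mul0mx add0r.
Qed.

Lemma expform_trace_prod5 n (A : 'M[C]_n) (G1 G2 G3 G4 : R -> R -> 'M[C]_n) D1 D2 D3 D4
    P1 P2 P3 P4 :
  mxexpform G1 D1 -> mxexpform G2 D2 -> mxexpform G3 D3 -> mxexpform G4 D4 ->
  G1 0 0 = P1 -> G2 0 0 = P2 -> G3 0 0 = P3 -> G4 0 0 = P4 ->
  A *m D1 = D1 *m A -> A *m P1 = A ->
  A *m P2 = A -> P2 *m A = A -> A *m P3 = A -> P3 *m A = A -> A *m P4 = A -> P4 *m A = A ->
  expform (fun x y => \tr (A *m G1 x y *m G2 x y *m G3 x y *m G4 x y))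
   (\tr (A *m D1) + \tr (A *m D2) + \tr (A *m D3) + \tr (A *m D4)).
Proof.
move=> h1 h2 h3 h4 e1 e2 e3 e4 c1 p1 p2 q2 p3 q3 p4 q4.
have := mxexpform_tr (mxexpform_prod5 A h1 h2 h3 h4).
rewrite e1 e2 e3 e4 p1 p2 p3.
by rewrite mxtrace_supp_derivative.
Qed.

Lemma Re_lincomb (a b c d e : R) (r x y z : C) :
  complex.Re (a%:C * r + b%:C * x + c%:C * y + d%:C * z + e%:C) =
  a * complex.Re r + b * complex.Re x + c * complex.Re y + d * complex.Re z + e.
Proof.
by case: r => ? ?; case: x => ? ?; case: y => ? ?; case: z => ? ? /=; rewrite !mul0r !subr0.
Qed.

Lemma Re_alternating (r x y z : C) : complex.Re (- r + x - y + z) =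
  - complex.Re r + complex.Re x - complex.Re y + complex.Re z.
Proof. by case: r => ? ?; case: x => ? ?; case: y => ? ?; case: z => ? ?. Qed.

Lemma half_alternating_le (r x y z l : R) :
  - 2^-1 * r + 2^-1 * x + - 2^-1 * y + 2^-1 * z + - l <= 0 -> - r + x - y + z <= 2 * l.
Proof. lra. Qed.

(** X, Y, Z are arbitrary here, subject only to their supports containing that of rho: the tensor
    structure plays its part later, in identifying the bound on Re z = 1 with a fidelity. *)
Lemma petz_three_lines n (rho X Y Z : 'M[C]_n) (m : R) :
  psd rho -> \tr rho = 1 -> psd X -> psd Y -> psd Z ->
  rho *m suppmx X = rho -> rho *m suppmx Y = rho -> rho *m suppmx Z = rho -> 0 < m ->
  let M (t : R) := fcalc (cpow 2^-1 (2^-1 * t)) X *m fcalc (cpow (- 2^-1) (- 2^-1 * t)) Y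
             *m fcalc (cpow 2^-1 (2^-1 * t)) Z in
  (forall t, \tr (rootmx (rootmx rho *m M t *m (rootmx rho *m M t)^t*)) <= m%:C) ->
  complex.Re (- \tr (rho *m lnmx rho) + \tr (rho *m lnmx X) - \tr (rho *m lnmx Y)
    + \tr (rho *m lnmx Z)) <= 2 * ln m.
Proof.
move=> r0 r1 X0 Y0 Z0 rX rY rZ m0 M Hm.
pose H A (a : R) (x y : R) : 'M[C]_n := fcalc (cpow (a * x) (a * y)) A.
pose f x y := \tr (rho *m H rho (- 2^-1) x y *m H X 2^-1 x y *m H Y (- 2^-1) x y
   *m H Z 2^-1 x y).
have H0 A a : H A a 0 0 = suppmx A.
  by rewrite /H !mulr0; apply: eq_fcalc => i; rewrite cpow00.
have suppl A : rho *m suppmx A = rho -> suppmx A *m rho = rho.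
  by move=> h; rewrite -[LHS]trmxCK adjmxM suppmx_adj (psd_adj r0) h (psd_adj r0).
have rr : rho *m suppmx rho = rho.
  rewrite -{1}(fcalc_id_psd r0) fcalcM -[RHS](fcalc_id_psd r0); apply: eq_fcalc => i.
  by rewrite /supp; case: eqVneq => [->|_]; rewrite ?mul0r ?mulr1.
pose D : C := (- 2^-1)%:C * \tr (rho *m lnmx rho) + (2^-1)%:C * \tr (rho *m lnmx X)
  + (- 2^-1)%:C * \tr (rho *m lnmx Y) + (2^-1)%:C * \tr (rho *m lnmx Z).
have fD : expform f D.
  have hH A a : mxexpform (H A a) (a%:C *: lnmx A) by exact: mxexpform_cpow.
  have c1 : rho *m ((- 2^-1)%:C *: lnmx rho) = ((- 2^-1)%:C *: lnmx rho) *m rho.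
    rewrite -scalemxAr -scalemxAl; congr (_ *: _).
    by have := fcalc_comm id (fun l => (ln (complex.Re l))%:C) rho; rewrite (fcalc_id_psd r0).
  have := expform_trace_prod5 (hH rho (- 2^-1)) (hH X 2^-1)
     (hH Y (- 2^-1)) (hH Z 2^-1) (H0 _ _) (H0 _ _) (H0 _ _) (H0 _ _) c1 rr
     rX (suppl _ rX) rY (suppl _ rY) rZ (suppl _ rZ).
  apply: expform_ext => //.
  have E (a : C) (B : 'M[C]_n) : \tr (rho *m (a *: B)) = a * \tr (rho *m B).
    by rewrite -scalemxAr mxtraceZ.
  exact: (congr2 +%R (congr2 +%R (congr2 +%R (E _ _) (E _ _)) (E _ _)) (E _ _)).
have f00 : f 0 0 = 1 by rewrite /f !H0 rr rX rY rZ.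
(* The factor m^(-z) brings the bound on Re z = 1 down to 1 and subtracts ln m from the slope at
   0. *)
have [s [sg sD]] := expform_mul fD (expform_cexp (- ln m)).
have nf0 y : `|f 0 y| <= 1.
  by rewrite /f /H !mulr0; apply: trace_contractions_le1 => // l; apply: normc_cpow0.
have nf1 y : `|f 1 y| <= m%:C.
  apply: le_trans (Hm y).
  rewrite /f /H !mulr1; apply: (@trace_half_le _ _ _ r0 _ _ _ _ (cpow 0 (- 2^-1 * y))) => // [l|l l0]; first exact: normc_cpow0.
  exact: mul_cpow_half.
have : complex.Re (\sum_(p <- s) p.1 * p.2%:C) <= 0.
  apply: Re_expsum_slope => [y|y|].
  - rewrite -sg; apply: Re_le_norm; rewrite normrM normc_cexp mulr0 expR0 mulr1.
    exact: nf0.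
  - rewrite -sg; apply: Re_le_norm; rewrite normrM normc_cexp mulr1 expRN lnK ?posrE //.
    rewrite fmorphV ler_pdivrMr ?ltcR //.
    by move: (nf1 y); rewrite -[X in _ <= X]mul1r.
  - by rewrite -sg !mulr0 cexp00 mulr1 f00.
have -> : \sum_(p <- s) p.1 * p.2%:C = D + (- ln m)%:C.
  rewrite sD f00. by rewrite mul1r !mulr0 cexp00 mulr1.
rewrite /D.
rewrite Re_lincomb Re_alternating.
exact: half_alternating_le.
Qed.

End Core.

(** * The boundary values as recovery fidelities *)

Section PetzGram.
Variable K : numClosedFieldType.

Lemma fcalc_gram (f : K -> K) n (A : 'M[K]_n) : psd A ->
  (forall x, 0 <= x -> (f x)^* * f x = x) -> fcalc f A *m (fcalc f A)^t* = A.
Proof.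
move=> A0 f2; rewrite fcalc_adj fcalcM -[RHS]fcalc_id_psd //.
by apply: eq_fcalc_psd => // x x0; rewrite mulrC f2.
Qed.

Lemma mul_lift_lift_supp n m k p q (e : subsystem n m k) (e' : subsystem m p q) (A : 'M[K]_n) :
  psd A -> A *m lift_sub e (lift_sub e' (suppmx (ptrace_sub e' (ptrace_sub e A)))) = A.
Proof.
move=> A0; set B := ptrace_sub e' _.
have B0 : psd B by do 2!apply: ptrace_sub_psd.
have ker0 : A *m lift_sub e (lift_sub e' (kermx_proj B)) = 0.
  apply: mul_eq0_psd => //.
  rewrite mxtrace_mulC -!lift_sub_adj kermx_proj_adj mulmxA -!lift_subM mxtrace_mulC.
  by rewrite !mxtrace_lift_sub -/B mulmxA mul_kermx_proj ?mul0mx ?mxtrace0.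
rewrite -[RHS]mulmx1 -(lift_sub1 _ e) -(lift_sub1 _ e') -(suppmxD_kermx B) !lift_subD.
by rewrite mulmxDr ker0 addr0.
Qed.

(** Since [fcalc f Z] times its adjoint is [Z], the padded A B marginal appears in the middle, and
    the outer factors are those of the Petz map. The trace of the root of this matrix is thus a root
    fidelity. *)
Lemma petz_gram a b c (rho : 'M[K]_(a * (b * c))) (f g : K -> K) : psd rho ->
  (forall x, 0 <= x -> (f x)^* * f x = x) ->
  let sigma := ptrace_sub (snd_sub a (b * c)) rho in
  let rhoAB := ptrace_sub (assoc_sub a b c) rho in
  let X := lift_sub (snd_sub a (b * c)) sigma in
  let Y := lift_sub (snd_sub a (b * c)) (lift_sub (fst_sub b c) (ptrace_sub (fst_sub b c) sigma)) in
  let Z := lift_sub (assoc_sub a b c) rhoAB in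
  let M := fcalc f X *m fcalc g Y *m fcalc f Z in
  rootmx rho *m M *m (rootmx rho *m M)^t* =
  rootmx rho *m id_tensor (petz sigma f g) rhoAB *m rootmx rho.
Proof.
move=> r0 f2 sigma rhoAB X Y Z M.
have s0 : psd sigma by exact: ptrace_sub_psd.
have sB0 : psd (ptrace_sub (fst_sub b c) sigma) by exact: ptrace_sub_psd.
have Z0 : psd Z by apply/lift_sub_psd/ptrace_sub_psd.
have assoc n (A B : 'M[K]_n) : (A *m B) *m (A *m B)^t* = A *m (B *m B^t*) *m A^t*.
  by rewrite adjmxM !mulmxA.
rewrite assoc (rootmx_adj r0); congr (_ *m _ *m _).
rewrite id_tensor_petz_marginal // /M assoc fcalc_gram //.
rewrite /X /Y (lift_sub_fcalc _ _ (psd_normal s0)).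
rewrite (lift_sub_fcalc _ _ (lift_sub_normal _ (psd_normal sB0))).
by rewrite (lift_sub_fcalc _ _ (psd_normal sB0)).
Qed.

End PetzGram.

(** * The Fawzi-Renner inequality *)

Section FawziRenner.
Variable R : realType.
Local Notation C := R[i].

Lemma cpow_half_conj t (x : C) : 0 <= x ->
  (cpow 2^-1 t x)^*%R * cpow 2^-1 t x = x.
Proof.
have e : 2^-1 + 2^-1 = 1 :> R by lra.
by move=> x0; rewrite cpow_conj -cpowD e addNr cpow10.
Qed.

Lemma cpow_Nhalf_conj t (x : C) : 0 <= x ->
  (cpow (- 2^-1) t x)^*%R * x * cpow (- 2^-1) t x = supp x.
Proof.
have e : - 2^-1 + 1 + - 2^-1 = 0 :> R by lra.
move=> x0; transitivity ((cpow (- 2^-1) t x)^*%R * cpow 1 0 x * cpow (- 2^-1) t x).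
  by rewrite cpow10.
by rewrite cpow_conj -!cpowD e addr0 addNr cpow00.
Qed.

Definition ent n (A : 'M[C]_n) : R := - complex.Re (\tr (A *m lnmx A)).

Lemma mxtrace_lnmx_lift n m k (e : subsystem n m k) (A : 'M[C]_n) : psd A ->
  \tr (A *m lnmx (lift_sub e (ptrace_sub e A))) =
  \tr (ptrace_sub e A *m lnmx (ptrace_sub e A)).
Proof.
move=> A0; rewrite /lnmx lift_sub_fcalc ?mxtrace_lift_sub //.
by apply/psd_normal/ptrace_sub_psd.
Qed.

Lemma Re_alternating_le (r x y z x' y' z' : C) (l : R) : x = x' -> y = y' -> z = z' ->
  complex.Re (- r + x - y + z) <= l ->
  - complex.Re r - - complex.Re x' + - complex.Re y' - - complex.Re z' <= l.
Proof. by move=> <- <- <-; rewrite Re_alternating !opprK. Qed.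

(** The left-hand side is - I(A:C|B). Each trace of rho against the logarithm of a padded marginal
    becomes an entropy of that marginal by duality. *)
Lemma petz_recovery a b c (rho : 'M[C]_(a * (b * c))) (m : R) :
  psd rho -> \tr rho = 1 -> 0 < m ->
  let sigma := ptrace_sub (snd_sub a (b * c)) rho in
  let rhoAB := ptrace_sub (assoc_sub a b c) rho in
  (forall t, \tr (rootmx (rootmx rho *m
      id_tensor (petz sigma (cpow 2^-1 (2^-1 * t)) (cpow (- 2^-1) (- 2^-1 * t))) rhoAB
      *m rootmx rho)) <= m%:C) ->
  ent rho - ent sigma + ent (ptrace_sub (fst_sub b c) sigma) - ent rhoAB <= 2 * ln m.
Proof.
move=> r0 r1 m0 sigma rhoAB Hm.
have s0 : psd sigma by exact: ptrace_sub_psd.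
have sB0 : psd (ptrace_sub (fst_sub b c) sigma) by exact: ptrace_sub_psd.
have AB0 : psd rhoAB by exact: ptrace_sub_psd.
pose X := lift_sub (snd_sub a (b * c)) sigma.
pose Y := lift_sub (snd_sub a (b * c)) (lift_sub (fst_sub b c) (ptrace_sub (fst_sub b c) sigma)).
pose Z := lift_sub (assoc_sub a b c) rhoAB.
have X0 : psd X by exact: lift_sub_psd.
have Y0 : psd Y by apply/lift_sub_psd/lift_sub_psd.
have Z0 : psd Z by exact: lift_sub_psd.
have rX : rho *m suppmx X = rho.
  by rewrite /suppmx lift_sub_fcalc ?mul_lift_supp //; apply: psd_normal.
have rZ : rho *m suppmx Z = rho.
  by rewrite /suppmx lift_sub_fcalc ?mul_lift_supp //; apply: psd_normal.
have rY : rho *m suppmx Y = rho.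
  rewrite /suppmx lift_sub_fcalc; last exact/lift_sub_normal/psd_normal.
  by rewrite lift_sub_fcalc ?mul_lift_lift_supp //; apply: psd_normal.
have := petz_three_lines r0 r1 X0 Y0 Z0 rX rY rZ m0.
have trX : \tr (rho *m lnmx X) = \tr (sigma *m lnmx sigma) by exact: mxtrace_lnmx_lift.
have trZ : \tr (rho *m lnmx Z) = \tr (rhoAB *m lnmx rhoAB) by exact: mxtrace_lnmx_lift.
have trY : \tr (rho *m lnmx Y) =
    \tr (ptrace_sub (fst_sub b c) sigma *m lnmx (ptrace_sub (fst_sub b c) sigma)).
  rewrite {1}/lnmx lift_sub_fcalc; last exact/lift_sub_normal/psd_normal.
  by rewrite mxtrace_lift_sub -/sigma; apply: mxtrace_lnmx_lift.
move=> H.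
have Hm' t : \tr (rootmx (rootmx rho *m (fcalc (cpow 2^-1 (2^-1 * t)) X *m
     fcalc (cpow (- 2^-1) (- 2^-1 * t)) Y *m fcalc (cpow 2^-1 (2^-1 * t)) Z) *m
     (rootmx rho *m (fcalc (cpow 2^-1 (2^-1 * t)) X *m
     fcalc (cpow (- 2^-1) (- 2^-1 * t)) Y *m fcalc (cpow 2^-1 (2^-1 * t)) Z))^t*)) <= m%:C.
  by rewrite (petz_gram (cpow (- 2^-1) (- 2^-1 * t)) r0 (@cpow_half_conj (2^-1 * t))).
exact: (Re_alternating_le trX trY trZ (H Hm')).
Qed.

End FawziRenner.

(** * Existence of an optimal channel *)

Section Compactness.
Import numFieldNormedType.Exports.
Variable R : realType.
Local Notation C := R[i].

(** The superlevel sets of values taken on P are nested and generate a proper filter; a cluster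
    point in the compact P belongs to each of them, as they are closed. *)
Lemma usc_attains_max N (P : set 'rV[R]_N) (h : 'rV[R]_N -> R) :
  compact P -> P !=set0 -> (forall c, closed [set v | P v /\ c <= h v]) ->
  exists2 v, P v & forall w, P w -> h w <= h v.
Proof.
move=> Pc [v0 Pv0] hcl.
pose B w := [set v | P v /\ h w <= h v].
pose F := filter_from P B.
have FF : ProperFilter F.
  apply: filter_from_proper; last by move=> w Pw; exists w; split.
  apply: filter_from_filter; first by exists v0.
  move=> u w Pu Pw; have [uw|wu] := leP (h u) (h w).
    by exists w => // v [Pv hv]; split; split => //; apply: le_trans hv.
  by exists u => // v [Pv hv]; split; split => //; apply: le_trans (ltW wu) hv.
have FP : F P by exists v0 => // v [].
have [p [Pp clp]] := Pc F FF FP.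
exists p => // w Pw.
have /hcl [] // : closure (B w) p.
by move=> U Up; apply: clp => //; exists w.
Qed.

(** Only real-linear: maps between complex matrices are described by real coordinates. *)
Definition Rlinear N (l : 'rV[R]_N -> C) :=
  forall (a : R) u v, l (a *: u + v) = a%:C * l u + l v.

Lemma linear_form_continuous N (l : 'rV[R]_N -> R) :
  (forall a u v, l (a *: u + v) = a * l u + l v) -> continuous l.
Proof.
move=> lin.
have l0 : l 0 = 0 by have := lin (-1) 0 0; rewrite scaler0 addr0 mulN1r addNr.
have lE : l = fun v => \sum_(k <- enum 'I_N) v 0 k * l (delta_mx 0 k).
  apply/funext => v; rewrite [in LHS](row_sum_delta v) -big_enum /=.
  elim: (enum 'I_N) => [|k s IH]; first by rewrite !big_nil.
  by rewrite !big_cons lin IH.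
rewrite lE; elim: (enum 'I_N) => [|k s IH].
  under eq_fun do rewrite big_nil; exact: cst_continuous.
under eq_fun do rewrite big_cons.
move=> v.
have h1 : (fun v : 'rV[R]_N => v 0 k * l (delta_mx 0 k)) x @[x --> v] --> v 0 k * l (delta_mx 0 k).
  exact: (cvgM (@coord_continuous R 1 N 0 k v) (cvg_cst (l (delta_mx 0 k)))).
exact: cvgD h1 (IH v).
Qed.

Lemma Rlinear_Re N (l : 'rV[R]_N -> C) : Rlinear l -> continuous (fun v => complex.Re (l v)).
Proof.
move=> lin; apply: linear_form_continuous => a u v; rewrite lin.
by case: (l u) => ? ?; case: (l v) => ? ? /=; rewrite mul0r subr0.
Qed.

Lemma Rlinear_Im N (l : 'rV[R]_N -> C) : Rlinear l -> continuous (fun v => complex.Im (l v)).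
Proof.
move=> lin; apply: linear_form_continuous => a u v; rewrite lin.
by case: (l u) => ? ?; case: (l v) => ? ? /=; rewrite mul0r addr0.
Qed.

Lemma closed_Rlinear_Re_ge N (l : 'rV[R]_N -> C) (c : R) : Rlinear l ->
  closed [set v | c <= complex.Re (l v)].
Proof.
move=> /Rlinear_Re lc.
exact: (preimage_closed (f := fun v => complex.Re (l v)) (D := [set x | c <= x])
  (fun x _ => lc x) (@closed_ge _ c)).
Qed.

Lemma closed_preimage_eq (T : topologicalType) (l : T -> R) (c : R) :
  continuous l -> closed [set v | l v = c].
Proof.
by move=> lc; apply: (preimage_closed (D := [set x | x = c])) => [v _|];
  [exact: lc|exact: closed_eq].
Qed.

Lemma closed_Rlinear_eq N (l : 'rV[R]_N -> C) (c : C) : Rlinear l ->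
  closed [set v | l v = c].
Proof.
move=> lin.
rewrite (_ : mkset _ = [set v | complex.Re (l v) = complex.Re c] `&`
                       [set v | complex.Im (l v) = complex.Im c]); last first.
  apply/seteqP; split => v /=; first by move=> ->.
  by move=> [h1 h2]; apply/eqP; rewrite eq_complex h1 h2 !eqxx.
have h1 := closed_preimage_eq (c := complex.Re c) (Rlinear_Re lin).
have h2 := closed_preimage_eq (c := complex.Im c) (Rlinear_Im lin).
exact: closedI h1 h2.
Qed.

Lemma closed_Rlinear_ge0 N (l : 'rV[R]_N -> C) : Rlinear l -> closed [set v | 0 <= l v].
Proof.
move=> lin.
rewrite (_ : mkset _ = [set v | 0 <= complex.Re (l v)] `&`
                       [set v | complex.Im (l v) = 0]); last first.
  apply/seteqP; split => v /=; rewrite lecE /=.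
    by move=> /andP[/eqP -> ->].
  by move=> [-> ->]; rewrite eqxx.
exact: closedI (closed_Rlinear_Re_ge (c := 0) lin) (closed_preimage_eq (c := 0) (Rlinear_Im lin)).
Qed.

Lemma closed_forall (T : topologicalType) (I : Type) (Q : I -> Prop) (A : I -> set T) :
  (forall i, Q i -> closed (A i)) -> closed [set v | forall i, Q i -> A i v].
Proof.
move=> h; have := @closed_bigI _ _ (Q : set I) A h.
by rewrite (_ : \bigcap_(i in _) _ = [set v | forall i, Q i -> A i v]).
Qed.

End Compactness.

Section EntryBound.
Variable K : numClosedFieldType.

(** Entries of A are inner products of rows of its root, and each row has squared norm at most the
    trace of A. *)
Lemma psd_entry_le n (A : 'M[K]_n) i j : psd A -> `|A i j| <= \tr A.
Proof.
move=> A0; have sA : hsnorm2 (rootmx A) = \tr A by rewrite /hsnorm2 rootmx_adj // rootmxK.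
have rowle m p (B : 'M[K]_(m, p)) k : hsnorm2 (row k B) <= hsnorm2 B.
  rewrite !hsnorm2E big_ord1 [X in _ <= X](bigD1 k) //=.
  under eq_bigr => l _ do rewrite mxE.
  by rewrite lerDl; apply: sumr_ge0 => l _; apply: sumr_ge0 => ? _; rewrite exprn_ge0.
have -> : A i j = \tr (row i (rootmx A) *m (row j (rootmx A))^t*).
  rewrite -{1}(rootmxK A0) /mxtrace big_ord1 !mxE; apply: eq_bigr => k _.
  by rewrite -{2}(rootmx_adj A0) !mxE.
rewrite -ler_sqr ?nnegrE ?mxtrace_psd //.
apply: le_trans (mxtrace_mul_CauchySchwarz _ _) _.
rewrite hsnorm2_adj expr2 -sA; apply: ler_pM => //; exact: hsnorm2_ge0.
Qed.

End EntryBound.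

(** * The compact set of channels and semicontinuity of the root fidelity *)

Section ChannelMax.
Import numFieldNormedType.Exports.
Variable R : realType.
Local Notation C := R[i].

Section Coordinates.
Variables n p : nat.

(** Indices of the entry (k, l) of the image of the matrix unit (i, j); the boolean selects the
    imaginary part. *)
Definition coord_index := ('I_n * 'I_n * ('I_p * 'I_p) * bool)%type.

Local Notation coords := 'rV[R]_#|{: coord_index}|.

Definition coord_entry (v : coords) i j k l : C :=
  v 0 (enum_rank ((i, j, (k, l), false) : coord_index)) +i*
  v 0 (enum_rank ((i, j, (k, l), true) : coord_index)).

Definition coord_map (v : coords) (X : 'M[C]_n) : 'M[C]_p :=
  \matrix_(k, l) \sum_i \sum_j X i j * coord_entry v i j k l.

Lemma coord_map_is_linear v : linear (coord_map v).
Proof.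
move=> a X Y; apply/matrixP => k l; rewrite !mxE mulr_sumr -big_split.
apply: eq_bigr => i _ /=; rewrite mulr_sumr -big_split.
by apply: eq_bigr => j _ /=; rewrite !mxE mulrDl mulrA.
Qed.

HB.instance Definition _ v := GRing.isLinear.Build C _ _ _ (coord_map v) (coord_map_is_linear v).

Lemma coord_mapD a u v X : coord_map (a *: u + v) X = a%:C *: coord_map u X + coord_map v X.
Proof.
apply/matrixP => k l; rewrite !mxE mulr_sumr -big_split.
apply: eq_bigr => i _ /=; rewrite mulr_sumr -big_split.
apply: eq_bigr => j _ /=; rewrite mulrCA -mulrDr; congr (_ * _).
by rewrite /coord_entry !mxE; simpc.
Qed.

Definition map_coord (F : 'M[C]_n -> 'M[C]_p) : coords :=
  \row_s let: (i, j, (k, l), b) := enum_val s : coord_index in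
    if b then complex.Im (F (delta_mx i j) k l) else complex.Re (F (delta_mx i j) k l).

Lemma map_coordK (F : {linear 'M[C]_n -> 'M[C]_p}) X : coord_map (map_coord F) X = F X.
Proof.
rewrite [in RHS](matrix_sum_delta X) linear_sum; apply/matrixP => k l; rewrite mxE summxE.
apply: eq_bigr => i _; rewrite linear_sum summxE; apply: eq_bigr => j _.
rewrite linearZ mxE; congr (_ * _); rewrite /coord_entry !mxE !enum_rankK /=.
by case: (F _ k l).
Qed.

Definition channel_coords : set coords := [set v |
  (forall (k : nat) (X : 'M[C]_(k * n)), psd X -> psd (id_tensor (coord_map v) X)) /\
  (forall X, \tr (coord_map v X) = \tr X)].

Lemma id_tensor_coordD k a u v (X : 'M[C]_(k * n)) :
  id_tensor (coord_map (a *: u + v)) X =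
  a%:C *: id_tensor (coord_map u) X + id_tensor (coord_map v) X.
Proof. by apply/matrixP => s t; rewrite mxE coord_mapD !mxE. Qed.

Lemma closed_channel_coords : closed channel_coords.
Proof.
(* Test data: an ancilla dimension, a matrix and a vector. Each turns complete positivity into one
   condition on a linear form in the coordinates. *)
pose I := {k : nat & ('M[C]_(k * n) * 'cV[C]_(k * p))%type}.
pose l (i : I) v := ((projT2 i).2^t* *m id_tensor (coord_map v) (projT2 i).1 *m (projT2 i).2) 0 0.
rewrite (_ : channel_coords =
  [set v | forall i : I, psd (projT2 i).1 -> 0 <= l i v] `&`
  [set v | forall X : 'M[C]_n, True -> \tr (coord_map v X) = \tr X]); last first.
  apply/seteqP; split => v [h1 h2]; split => //.
  - by move=> [k [X w]] /= X0; apply: h1.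
  - by move=> k X X0 w; apply: (h1 (existT _ k (X, w))).
  - by move=> X; apply: h2.
apply: closedI.
  apply: closed_forall => i _; apply: closed_Rlinear_ge0 => a u v.
  rewrite /l id_tensor_coordD mulmxDr mulmxDl -scalemxAr -scalemxAl.
  by rewrite mxE [X in X + _]mxE.
apply: closed_forall => X _; apply: closed_Rlinear_eq => a u v.
by rewrite coord_mapD raddfD /= mxtraceZ.
Qed.

(* The entries of the coordinate matrices are those of the Choi matrix of the map, which is positive of trace n. *)
Lemma channel_coords_bounded v s : channel_coords v -> `|v 0 s| <= n%:R.
Proof.
move=> [cp tp].
(* The unnormalized maximally entangled vector, whose blocks are the matrix units. *)
pose w : 'cV[C]_(n * n) := \col_i ((mxtens_unindex i).1 == (mxtens_unindex i).2)%:R.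
pose J := id_tensor (coord_map v) (w *m w^t*).
have blockE i j : \matrix_(x, y) (w *m w^t*) (mxtens_index (i, x)) (mxtens_index (j, y)) = delta_mx i j.
  apply/matrixP => x y; rewrite !mxE big_ord1 !mxE !unindexE rmorph_nat -natrM mulnb.
  by rewrite eq_sym [y == j]eq_sym.
have JE i j k l : J (mxtens_index (i, k)) (mxtens_index (j, l)) = coord_entry v i j k l.
  rewrite mxE !unindexE blockE mxE (bigD1 i) //= (bigD1 j) //= big1 ?addr0.
    rewrite big1 ?addr0; first by rewrite mxE !eqxx mul1r.
    move=> x /negPf xi; apply: big1 => y _.
    by rewrite mxE xi mul0r.
  by move=> y /negPf yj; rewrite mxE yj andbF mul0r.
have J0 : psd J by apply/cp/psd_gram.
have trJ : \tr J = n%:R.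
  rewrite /mxtrace (sum_sub (fst_sub n p)).
  transitivity (\sum_(i < n) \tr (coord_map v (delta_mx i i))).
    apply: eq_bigr => i _; apply: eq_bigr => k _; rewrite !subE.
    by rewrite mxE !unindexE blockE.
  rewrite (eq_bigr (fun=> 1)); first by rewrite sumr_const card_ord.
  move=> i _; rewrite tp /mxtrace (bigD1 i) //= big1 ?addr0 ?mxE ?eqxx //.
  by move=> j /negPf ji; rewrite mxE ji.
have bound i j k l : `|coord_entry v i j k l| <= (n%:R)%:C.
  by rewrite -JE rmorph_nat -trJ; apply: psd_entry_le.
rewrite -lecR -(enum_valK s); move: (enum_val s) => [[[i j] [k l]] b].
apply: le_trans (bound i j k l); rewrite normc_def lecR /=.
have sl (x y : R) : `|x| <= Num.sqrt (x ^+ 2 + y ^+ 2).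
  by rewrite -sqrtr_sqr ler_wsqrtr // lerDl sqr_ge0.
by case: b; last exact: sl; rewrite addrC; exact: sl.
Qed.

Lemma compact_channel_coords : compact channel_coords.
Proof.
apply: bounded_closed_compact; last exact: closed_channel_coords.
exists n%:R; split; first exact: num_real.
move=> M Mn v Pv.
suff : `|v| <= M by [].
rewrite [leLHS]/Num.Def.normr /= mx_normrE; apply: bigmax_le => [|[i s] _] /=.
  by apply: le_trans (ltW Mn); rewrite ler0n.
by apply: le_trans (ltW Mn); rewrite ord1; apply: channel_coords_bounded.
Qed.

End Coordinates.

Definition root_fidelity n (rho sigma : 'M[C]_n) : R :=
  complex.Re (\tr (rootmx (rootmx rho *m sigma *m rootmx rho))).

(** T depends linearly on the channel but its root does not. The variational formula replaces the
    bound on the root by the bounds 2 c - tr Y <= tr (T Z), linear in the coordinates, over all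
    pairs of inverse positive Y and Z. *)
Lemma closed_root_fidelity_ge n p a (rho : 'M[C]_(a * p)) (omega : 'M[C]_(a * n)) (c : R) :
  psd rho -> psd omega ->
  closed [set v : 'rV[R]_#|{: coord_index n p}| | channel_coords v /\
     c <= root_fidelity rho (id_tensor (coord_map v) omega)].
Proof.
move=> r0 o0; set S := rootmx rho.
pose T v := S *m id_tensor (coord_map v) omega *m S.
pose I := ('M[C]_(a * p) * 'M[C]_(a * p))%type.
pose Q (i : I) := [/\ psd i.1, psd i.2 & i.2 *m i.1 = 1%:M].
have T0 v : channel_coords v -> psd (T v).
  have Sadj : S^t* = S by exact: rootmx_adj.
  by move=> [cp _]; rewrite /T -{2}Sadj; apply/psd_congr/cp.
rewrite (_ : mkset _ = @channel_coords n p `&`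
  [set v | forall i : I, Q i -> 2 * c - complex.Re (\tr i.1) <= complex.Re (\tr (T v *m i.2))]);
  last first.
  apply/seteqP; split => v [Pv h]; split => //.
    move=> [Y Z] /= [Y0 Z0 ZY].
    have := trace_root_le (T0 v Pv) Z0 ZY; rewrite lecE => /andP[_].
    move: h; rewrite /root_fidelity -/S -/(T v).
    case: (\tr (rootmx _)) => x x'; case: (\tr Y) => y y'; case: (\tr (T v *m Z)) => z z' /=.
    by clear; lra.
  apply/ler_addgt0Pr => e e0.
  pose q : R := (a * p)%:R.
  have q0 : 0 <= q by exact: ler0n.
  (* The regularization costs d q <= 2 e, which is e after halving; the added one covers q = 0. *)
  pose d := 2 * e / (q + 1).
  have d0 : 0 < d by rewrite divr_gt0 ?mulr_gt0 // ltr_wpDl.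
  have dq : d * q <= 2 * e.
    rewrite /d -mulrA ler_piMr ?mulr_ge0 ?(ltW e0) // mulrC ler_pdivrMr ?ltr_wpDl //.
    by rewrite mul1r lerDl.
  have d0c : 0 < d%:C by rewrite ltcR.
  have [Y [Z [Y0 Z0 ZY]]] := trace_root_approx (T0 v Pv) d0c.
  have := h (Y, Z) (And3 Y0 Z0 ZY); rewrite /root_fidelity -/S -/(T v) /=.
  have mulCn (x : R) (k : nat) : x%:C * k%:R = (x * k%:R)%:C :> C.
    by rewrite rmorphM /= rmorph_nat.
  rewrite mulCn -/q.
  rewrite lecE => H /andP[_]; move: H dq.
  case: (\tr (rootmx _)) => x x'; case: (\tr Y) => y y'; case: (\tr (T v *m Z)) => z z' /=.
  by clear; lra.
apply: closedI; first exact: closed_channel_coords.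
apply: closed_forall => i _; apply: closed_Rlinear_Re_ge => b u v.
rewrite /T id_tensor_coordD mulmxDr !mulmxDl raddfD /=.
by rewrite -scalemxAr -!scalemxAl mxtraceZ.
Qed.

Lemma root_fidelity_attains_max n p a (rho : 'M[C]_(a * p)) (omega : 'M[C]_(a * n)) :
  psd rho -> psd omega -> (exists Phi : {linear 'M[C]_n -> 'M[C]_p}, channel Phi) ->
  exists2 Phi : {linear 'M[C]_n -> 'M[C]_p}, channel Phi &
    forall Psi : {linear 'M[C]_n -> 'M[C]_p}, channel Psi ->
      root_fidelity rho (id_tens Psi omega) <= root_fidelity rho (id_tens Phi omega).
Proof.
move=> r0 o0 [Phi0 ch0].
have coordE (Psi : {linear 'M[C]_n -> 'M[C]_p}) : coord_map (map_coord Psi) = Psi :> (_ -> _).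
  by apply/funext => X; apply: map_coordK.
have chP (Psi : {linear 'M[C]_n -> 'M[C]_p}) : channel Psi -> channel_coords (map_coord Psi).
  by move=> [cp tp]; split; rewrite coordE.
have [v Pv hv] := usc_attains_max (@compact_channel_coords n p)
  (ex_intro _ _ (chP _ ch0)) (fun c => closed_root_fidelity_ge (c := c) r0 o0).
exists (coord_map v : {linear _ -> _}); first by case: Pv.
by move=> Psi /chP /hv; rewrite coordE.
Qed.

End ChannelMax.

(** * Spectra of Gram matrices and of transposes *)

Section Schmidt.
Variable K : numClosedFieldType.

(** M intertwines its two Gram matrices, hence also their functions. This replaces the Schmidt
    decomposition; the Gram prefactor discards the kernels, whose dimensions may differ. *)
Lemma mxtrace_fcalc_gram f m n (M : 'M[K]_(m, n)) :
  \tr (M *m M^t* *m fcalc f (M *m M^t*)) = \tr (M^t* *m M *m fcalc f (M^t* *m M)).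
Proof.
have n1 : M *m M^t* \is normalmx by apply/psd_normal/psd_gram.
have n2 : M^t* *m M \is normalmx.
  by apply/psd_normal; rewrite -{2}[M]trmxCK; apply: psd_gram.
have h : fcalc f (M *m M^t*) *m M = M *m fcalc f (M^t* *m M).
  by apply: fcalc_intertwine => //; rewrite mulmxA.
have cycle (A : 'M[K]_(m, n)) (B : 'M[K]_(n, m)) (F : 'M[K]_m) :
    \tr (A *m B *m F) = \tr (B *m (F *m A)) by rewrite mulmxA [RHS]mxtrace_mulC mulmxA.
by rewrite cycle h (mulmxA (M^t*) M).
Qed.

(** The conjugate eigenbasis diagonalizes the transpose with the same eigenvalues. *)
Lemma fcalc_tr f n (A : 'M[K]_n) : A \is normalmx -> fcalc f A^T = (fcalc f A)^T.
Proof.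
move=> nA; have Uu := spectral_unitarymx A.
have Vu : map_mx Num.conj (spectralmx A) \is unitarymx by rewrite conjC_unitary.
have VE (D : 'rV[K]_n) : ((spectralmx A)^t* *m diag_mx D *m spectralmx A)^T =
    (map_mx Num.conj (spectralmx A))^t* *m diag_mx D *m map_mx Num.conj (spectralmx A).
  rewrite !trmx_mul tr_diag_mx mulmxA; congr (_ *m _ *m _).
    by apply/matrixP => i j; rewrite !mxE conjCK.
  by apply/matrixP => i j; rewrite !mxE.
rewrite [RHS]VE; apply: fcalc_diag => //.
by rewrite -VE -normalmx_spectral.
Qed.

Lemma mxtrace_fcalc_tr f n (A : 'M[K]_n) : A \is normalmx ->
  \tr (A^T *m fcalc f A^T) = \tr (A *m fcalc f A).
Proof. by move=> nA; rewrite fcalc_tr // -trmx_mul mxtrace_tr mxtrace_mulC. Qed.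

Lemma rootmx_lift n m k (e : subsystem n m k) (A : 'M[K]_m) : psd A ->
  rootmx (lift_sub e A) = lift_sub e (rootmx A).
Proof. by move=> A0; rewrite /rootmx lift_sub_fcalc //; apply: psd_normal. Qed.

End Schmidt.

(** * From the notions of the statement to those of the proof *)

Section Bridge.
Variable R : realType.
Local Notation C := R[i].

Lemma funmx_fcalc f n (A : 'M[C]_n) : funmx f A = fcalc f A.
Proof. by rewrite /funmx invmx_unitary // spectral_unitarymx. Qed.

Lemma sqrtmx_rootmx n (A : 'M[C]_n) : sqrtmx A = rootmx A.
Proof. exact: funmx_fcalc. Qed.

Lemma entropyE n (A : 'M[C]_n) : entropy A = ent A.
Proof. by rewrite /entropy /logmx funmx_fcalc. Qed.

Lemma fidelityE n (rho sigma : 'M[C]_n) : fidelity rho sigma = root_fidelity rho sigma ^+ 2.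
Proof. by rewrite /fidelity !sqrtmx_rootmx. Qed.

Lemma ent_gram m n (M : 'M[C]_(m, n)) : ent (M *m M^t*) = ent (M^t* *m M).
Proof. by rewrite /ent /lnmx mxtrace_fcalc_gram. Qed.

Lemma ent_tr n (A : 'M[C]_n) : A \is normalmx -> ent A^T = ent A.
Proof. by move=> nA; rewrite /ent /lnmx mxtrace_fcalc_tr. Qed.

(** With M the coefficient matrix of a pure vector, the two sides are the entropies of its
    complementary reduced states. *)
Lemma ent_gram_tr m n (M : 'M[C]_(m, n)) : ent (M^T *m M^T^t*) = ent (M *m M^t*).
Proof.
rewrite ent_gram -ent_tr; last first.
  by apply/psd_normal; rewrite -{2}[M^T]trmxCK; apply: psd_gram.
by congr ent; rewrite trmx_mul trmxK; congr (_ *m _); apply/matrixP => i j; rewrite !mxE.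
Qed.

(** With a one-dimensional complement, padding is a mere relabelling of the basis. *)
Lemma ent_reindex n m (e : subsystem n m 1) (A : 'M[C]_m) : psd A ->
  ent (lift_sub e A) = ent A.
Proof.
move=> A0; rewrite /ent /lnmx lift_sub_fcalc; last exact: psd_normal.
by rewrite -lift_subM mxtrace_lift mul1r.
Qed.

Lemma root_fidelity_reindex n m (e : subsystem n m 1) (rho sigma : 'M[C]_m) :
  psd rho -> psd sigma ->
  root_fidelity (lift_sub e rho) (lift_sub e sigma) = root_fidelity rho sigma.
Proof.
move=> r0 s0; rewrite /root_fidelity rootmx_lift // -!lift_subM rootmx_lift.
  by rewrite mxtrace_lift mul1r.
by rewrite -{2}(rootmx_adj r0); apply: psd_congr.
Qed.

Lemma root_fidelity_ge0 n (rho sigma : 'M[C]_n) : psd rho -> psd sigma ->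
  0 <= root_fidelity rho sigma.
Proof.
move=> r0 s0; rewrite -lecR /root_fidelity -ge0_complexE.
  by apply/mxtrace_psd/rootmx_psd; rewrite -{2}(rootmx_adj r0); apply: psd_congr.
by apply/mxtrace_psd/rootmx_psd; rewrite -{2}(rootmx_adj r0); apply: psd_congr.
Qed.

Definition unfold_vec m n (psi : 'cV[C]_(m * n)) : 'M[C]_(m, n) :=
  \matrix_(i, j) psi (mxtens_index (i, j)) 0.

Lemma reducedE m n (psi : 'cV[C]_(m * n)) :
  reduced psi = unfold_vec psi *m (unfold_vec psi)^t*.
Proof.
apply/matrixP => i j; rewrite !mxE; apply: eq_bigr => k _.
by rewrite !mxE big_ord1 !mxE.
Qed.

Lemma ptrace_leftE m n (X : 'M[C]_(m * n)) : ptrace_left X = ptrace_sub (snd_sub m n) X.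
Proof. by apply/matrixP => i j; rewrite !mxE. Qed.

Lemma ptrace_rightE m n (X : 'M[C]_(m * n)) : ptrace_right X = ptrace_sub (fst_sub m n) X.
Proof. by apply/matrixP => i j; rewrite !mxE. Qed.

Section State.
Variables (dA dB : nat) (rho : 'M[C]_(dA * dB)).
Hypothesis rho0 : psd rho.
Local Notation S := (rootmx rho).

Lemma coefE a b a' b' : coef (canonical_purification rho) a b a' b' =
  S (mxtens_index (a, b)) (mxtens_index (a', b')).
Proof. by rewrite /coef mxE !unindexE sqrtmx_rootmx. Qed.

Lemma unfold_ABBsE a b b' a' : unfold_vec (regroup_ABBs_As (canonical_purification rho))
  (mxtens_index (a, mxtens_index (b, b'))) a' = S (mxtens_index (a, b)) (mxtens_index (a', b')).
Proof. by rewrite mxE mxE !mxtens_indexK coefE. Qed.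

Lemma unfold_AAsE a a' b b' : unfold_vec (regroup_AAs_BBs (canonical_purification rho))
  (mxtens_index (a, a')) (mxtens_index (b, b')) = S (mxtens_index (a, b)) (mxtens_index (a', b')).
Proof. by rewrite mxE mxE !mxtens_indexK coefE. Qed.

Lemma unfold_AAsBE a a' b b' : unfold_vec (regroup_AAsB_Bs (canonical_purification rho))
  (mxtens_index (mxtens_index (a, a'), b)) b' = S (mxtens_index (a, b)) (mxtens_index (a', b')).
Proof. by rewrite mxE mxE !mxtens_indexK coefE. Qed.

Lemma rho_ABBs_psd : psd (rho_ABBs rho).
Proof. by rewrite /rho_ABBs reducedE; apply: psd_gram. Qed.

Lemma S_gram : S *m S^t* = rho.
Proof. by rewrite (rootmx_adj rho0) rootmxK. Qed.

Lemma ptrace_rho_ABBs : ptrace_sub (assoc_sub dA dB dB) (rho_ABBs rho) = rho.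
Proof.
rewrite /rho_ABBs reducedE -[RHS]S_gram; move: unfold_ABBsE.
move: (unfold_vec _) S => U T UE; apply/matrixP => i j.
case: (mxtens_indexP i) => a1 b1; case: (mxtens_indexP j) => a2 b2.
rewrite !mxE (sum_sub (snd_sub dA dB)); apply: eq_bigr => b' _.
rewrite mxE; apply: eq_bigr => a' _.
by rewrite !subE /assoc_pair !unindexE UE !mxE UE.
Qed.

(** By purity one may pass to the Gram matrix on the side of A', which is the A marginal of the
    square of the root of rho. *)
Lemma ent_rho_ABBs : ent (rho_ABBs rho) = ent (ptrace_right rho).
Proof.
rewrite /rho_ABBs reducedE ent_gram; congr ent.
have SS : rho = S^t* *m S by rewrite (rootmx_adj rho0) rootmxK.
rewrite ptrace_rightE [in RHS]SS; move: unfold_ABBsE.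
move: (unfold_vec _) S => U T UE; apply/matrixP => a1 a2; rewrite !mxE.
transitivity (\sum_(b' < dB) \sum_(i < dA * dB)
   (T i (mxtens_index (a1, b')))^*%R * T i (mxtens_index (a2, b'))); last first.
  by apply: eq_bigr => b' _; rewrite !mxE; apply: eq_bigr => i _; rewrite !mxE.
rewrite exchange_big (sum_sub (assoc_sub dA dB dB)).
apply: eq_bigr => i _; apply: eq_bigr => b' _; case: (mxtens_indexP i) => a b.
by rewrite !subE /assoc_pair !unindexE !mxE !UE.
Qed.

Lemma ptrace_rho_ABBs_BBs : ptrace_sub (snd_sub dA (dB * dB)) (rho_ABBs rho) =
  (unfold_vec (regroup_AAs_BBs (canonical_purification rho)))^T *m
  (unfold_vec (regroup_AAs_BBs (canonical_purification rho)))^T^t*.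
Proof.
rewrite /rho_ABBs reducedE; move: unfold_ABBsE unfold_AAsE.
move: (unfold_vec (regroup_ABBs_As _)) (unfold_vec (regroup_AAs_BBs _)) S => U V T UE VE.
apply/matrixP => i j.
case: (mxtens_indexP i) => b1 b1'; case: (mxtens_indexP j) => b2 b2'.
rewrite !mxE (sum_sub (fst_sub dA dA)); apply: eq_bigr => a _.
rewrite mxE; apply: eq_bigr => a' _.
by rewrite !subE UE !mxE UE !VE.
Qed.

(** B B' and A A' are complementary in a pure state. *)
Lemma ent_rho_BBs : ent (ptrace_sub (snd_sub dA (dB * dB)) (rho_ABBs rho)) = reflected_entropy rho.
Proof.
by rewrite ptrace_rho_ABBs_BBs ent_gram_tr /reflected_entropy /rho_AAs reducedE entropyE.
Qed.

End State.

End Bridge.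

(** * The first inequality *)

Section Recovery.
Variable R : realType.
Local Notation C := R[i].

Lemma petz_channel b c (sigma : 'M[C]_(b * c)) t t' : psd sigma -> (0 < c)%N ->
  channel (petz sigma (cpow 2^-1 t) (cpow (- 2^-1) t') : {linear 'M[C]_b -> 'M[C]_(b * c)}).
Proof.
move=> s0 c0; split; first by move=> k X X0; apply: petz_cp.
by move=> X; apply: petz_tp => // x x0; [apply: cpow_half_conj|apply: cpow_Nhalf_conj].
Qed.

Lemma lne_sqr_le (x y : R) : 0 <= x -> x <= y -> (lne (x ^+ 2)%:E <= lne (y ^+ 2)%:E)%E.
Proof.
move=> x0 xy; rewrite lee_lne ?in_itv /= ?leey ?lee_fin ?sqr_ge0 //.
by rewrite ler_sqr ?nnegrE // (le_trans x0).
Qed.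

(* Quantifying over all m >= F also excludes F = 0. *)
Lemma lne_sqr_ge (D F : R) : 0 <= F ->
  (forall m, 0 < m -> F <= m -> D <= 2 * ln m) -> (- lne (F ^+ 2)%:E <= (- D)%:E)%E.
Proof.
move=> F0 H.
have Fpos : 0 < F.
  rewrite lt_def F0 andbT; apply/negP => /eqP F00.
  (* If F = 0, every positive m is admissible; this one gives D <= D - 2. *)
  have := H (expR (D / 2 - 1)) (expR_gt0 _); rewrite F00 expR_ge0 expRK => /(_ isT).
  by lra.
rewrite lne_EFin ?exprn_gt0 // -EFinN lee_fin lnXn //.
by have := H F Fpos (lexx F); rewrite mulr2n; lra.
Qed.

Lemma density_dim_gt0 m n (rho : 'M[C]_(m * n)) : density rho -> (0 < n)%N.
Proof.
move=> [_ tr1]; case: n rho tr1 => [|n] // rho.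
rewrite /mxtrace big1 => [/eqP|i _]; first by rewrite eq_sym oner_eq0.
by have := leq_trans (ltn_ord i) (eq_leq (muln0 m)); rewrite ltn0.
Qed.

Lemma mxtrace_root_fidelity n (rho sigma : 'M[C]_n) : psd rho -> psd sigma ->
  \tr (rootmx (rootmx rho *m sigma *m rootmx rho)) = (root_fidelity rho sigma)%:C.
Proof.
move=> r0 s0; apply/ge0_complexE/mxtrace_psd/rootmx_psd.
by rewrite -{2}(rootmx_adj r0); apply: psd_congr.
Qed.

Variables (dA dB : nat) (rho : 'M[C]_(dA * dB)).
Hypothesis rho_density : density rho.
Let rho0 : psd rho. Proof. by case: rho_density. Qed.

Lemma root_fidelity_recovery_ge (m : R) : 0 < m ->
  (forall Phi : {linear 'M[C]_dB -> 'M[C]_(dB * dB)}, channel Phi ->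
     root_fidelity (rho_ABBs rho) (id_tens Phi rho) <= m) ->
  mutual_information rho - reflected_entropy rho <= 2 * ln m.
Proof.
move=> m0 Hm.
have r0 := rho_ABBs_psd rho.
have tr1 : \tr (rho_ABBs rho) = 1.
  by rewrite -(mxtrace_ptrace_sub (assoc_sub dA dB dB)) ptrace_rho_ABBs //; case: rho_density.
have s0 : psd (ptrace_sub (snd_sub dA (dB * dB)) (rho_ABBs rho)) by exact: ptrace_sub_psd.
have := petz_recovery r0 tr1 m0; cbv zeta.
rewrite -ptrace_sub_assoc ptrace_rho_ABBs // ent_rho_ABBs // ent_rho_BBs.
rewrite -ptrace_leftE /mutual_information !entropyE => H.
suff : ent (ptrace_right rho) - reflected_entropy rho + ent (ptrace_left rho) - ent rho <= 2 * ln m.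
  by lra.
apply: H => t.
have ch := petz_channel (2^-1 * t) (- 2^-1 * t) s0 (density_dim_gt0 rho_density).
have [cp _] := ch; have ps := cp _ _ rho0.
have h := Hm _ ch; rewrite -lecR in h.
apply: le_trans h; rewrite -(mxtrace_root_fidelity r0 ps); exact: lexx.
Qed.

Lemma max_recovery_fidelity : exists M : \bar R,
  is_max [set lne (fidelity (rho_ABBs rho) (id_tens Phi rho))%:E
         | Phi in [set Phi : {linear 'M[C]_dB -> 'M[C]_(dB * dB)} | channel Phi]] M
  /\ (- M <= (reflected_entropy rho - mutual_information rho)%:E)%E.
Proof.
have r0 := rho_ABBs_psd rho.
have s0 : psd (ptrace_sub (snd_sub dA (dB * dB)) (rho_ABBs rho)) by exact: ptrace_sub_psd.
(* The unrotated Petz map serves only to show that the set of channels is nonempty. *)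
have ch0 := petz_channel 0 0 s0 (density_dim_gt0 rho_density).
have [Phi ch max] := root_fidelity_attains_max r0 rho0 (ex_intro _ _ ch0).
have rf0 (Psi : {linear 'M[C]_dB -> 'M[C]_(dB * dB)}) : channel Psi ->
    0 <= root_fidelity (rho_ABBs rho) (id_tens Psi rho).
  by move=> [cp _]; exact: root_fidelity_ge0 r0 (cp _ _ rho0).
exists (lne (fidelity (rho_ABBs rho) (id_tens Phi rho))%:E); split.
  split; first by exists Phi.
  move=> _ [Psi chPsi <-].
  rewrite (fidelityE _ (id_tens Psi rho)) (fidelityE _ (id_tens Phi rho)).
  exact: lne_sqr_le (rf0 _ chPsi) (max _ chPsi).
rewrite fidelityE -opprB; apply: lne_sqr_ge (rf0 _ ch) _ => m m0 Fm.
exact: (root_fidelity_recovery_ge m0 (fun Psi chPsi => le_trans (max _ chPsi) Fm)).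
Qed.

End Recovery.

(** * Exchanging A and B *)

Section Swap.
Variable R : realType.
Local Notation C := R[i].

Section SwapIndex.
Variables m n : nat.

Definition swap_index (i : 'I_(m * n)) : 'I_(n * m) :=
  mxtens_index ((mxtens_unindex i).2, (mxtens_unindex i).1).

End SwapIndex.

Lemma swap_indexE m n (x : 'I_m) (y : 'I_n) :
  swap_index (mxtens_index (x, y)) = mxtens_index (y, x).
Proof. by rewrite /swap_index !unindexE. Qed.

Lemma swap_indexK m n : cancel (@swap_index m n) (@swap_index n m).
Proof. by move=> i; case: (mxtens_indexP i) => x y; rewrite !swap_indexE. Qed.

(** Encoded as a factorization with trivial complement, so that the results on padding apply to the
    exchange of factors. *)
Definition swap_sub m n : subsystem (n * m) (m * n) 1 :=
  @Subsystem (n * m) (m * n) 1 (@swap_index n m) (fun=> ord0) (fun i _ => swap_index i)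
    (fun i _ => swap_indexK i) (fun _ c => esym (ord1 c)) (@swap_indexK n m).

Lemma lift_swapE m n (X : 'M[C]_(m * n)) i j :
  lift_sub (swap_sub m n) X i j = X (swap_index i) (swap_index j).
Proof. by rewrite mxE eqxx mulr1n. Qed.

Variables (dA dB : nat) (rho : 'M[C]_(dA * dB)).
Hypothesis rho0 : psd rho.
Let rho' := lift_sub (swap_sub dA dB) rho.

Lemma swap_psd : psd rho'. Proof. exact: lift_sub_psd. Qed.

Lemma rootmx_swapE a b a' b' :
  rootmx rho' (mxtens_index (b, a)) (mxtens_index (b', a')) =
  rootmx rho (mxtens_index (a, b)) (mxtens_index (a', b')).
Proof. by rewrite /rho' rootmx_lift // lift_swapE !swap_indexE. Qed.

Lemma rho_AAsB_swap : rho_AAsB rho = lift_sub (swap_sub dB (dA * dA)) (rho_ABBs rho').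
Proof.
have UE := @unfold_AAsBE _ _ _ rho; have VE := @unfold_ABBsE _ _ _ rho'.
have SE := rootmx_swapE.
rewrite /rho_AAsB /rho_ABBs !reducedE; move: UE VE SE.
move: (unfold_vec (regroup_AAsB_Bs _)) (unfold_vec (regroup_ABBs_As _)) => U V.
move: (rootmx rho) (rootmx rho') => S S' UE VE SE.
apply/matrixP => i j; rewrite lift_swapE.
case: (mxtens_indexP i) => aa1 b1; case: (mxtens_indexP j) => aa2 b2.
case: (mxtens_indexP aa1) => a1 a1'; case: (mxtens_indexP aa2) => a2 a2'.
rewrite !swap_indexE !mxE; apply: eq_bigr => b' _.
by rewrite !mxE !UE !VE !SE.
Qed.

Lemma tens_id_swap p (Phi : {linear 'M[C]_dA -> 'M[C]_p}) :
  tens_id Phi rho = lift_sub (swap_sub dB p) (id_tens Phi rho').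
Proof.
apply/matrixP => s t; rewrite lift_swapE.
case: (mxtens_indexP s) => x1 b1; case: (mxtens_indexP t) => x2 b2.
rewrite !swap_indexE !mxE !unindexE; congr (Phi _ _ _); apply/matrixP => i i'.
by rewrite [RHS]mxE lift_swapE !swap_indexE mxE.
Qed.

Lemma ptrace_right_swap : ptrace_right rho' = ptrace_left rho.
Proof.
apply/matrixP => i j; rewrite !mxE; apply: eq_bigr => k _.
by rewrite lift_swapE !swap_indexE.
Qed.

Lemma ptrace_left_swap : ptrace_left rho' = ptrace_right rho.
Proof.
apply/matrixP => i j; rewrite !mxE; apply: eq_bigr => k _.
by rewrite lift_swapE !swap_indexE.
Qed.

Lemma mutual_information_swap : mutual_information rho' = mutual_information rho.
Proof.
rewrite /mutual_information ptrace_left_swap ptrace_right_swap !entropyE ent_reindex //.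
by rewrite [X in X - _]addrC.
Qed.

(** The exchange transposes the coefficient matrix between A A' and B B', and complementary reduced
    states have equal entropy. *)
Lemma reflected_entropy_swap : reflected_entropy rho' = reflected_entropy rho.
Proof.
rewrite /reflected_entropy !entropyE /rho_AAs !reducedE -[RHS]ent_gram_tr.
suff -> : unfold_vec (regroup_AAs_BBs (canonical_purification rho')) =
   (unfold_vec (regroup_AAs_BBs (canonical_purification rho)))^T by [].
apply/matrixP => i j; case: (mxtens_indexP i) => b b'; case: (mxtens_indexP j) => a a'.
by rewrite unfold_AAsE rootmx_swapE [RHS]mxE unfold_AAsE.
Qed.

Lemma density_swap : \tr rho = 1 -> density rho'.
Proof. by move=> tr1; split; [exact: swap_psd|rewrite mxtrace_lift tr1 mulr1]. Qed.

Lemma fidelity_swap (Phi : {linear 'M[C]_dA -> 'M[C]_(dA * dA)}) : channel Phi ->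
  fidelity (rho_AAsB rho) (tens_id Phi rho) = fidelity (rho_ABBs rho') (id_tens Phi rho').
Proof.
move=> [cp _]; rewrite !fidelityE rho_AAsB_swap tens_id_swap root_fidelity_reindex //.
  exact: rho_ABBs_psd.
exact/cp/swap_psd.
Qed.

End Swap.

Theorem mainTheorem2 (R : realType) (dA dB : nat) (rho : 'M[R[i]]_(dA * dB))
    (rho_density : density rho) :
  (exists M : \bar R,
     is_max [set lne (fidelity (rho_ABBs rho) (id_tens Phi rho))%:E
            | Phi in [set Phi : {linear 'M[R[i]]_dB -> 'M[R[i]]_(dB * dB)}
                     | channel Phi]] M
     /\ (- M <= (reflected_entropy rho - mutual_information rho)%:E)%E)
  /\
  (exists M : \bar R,
     is_max [set lne (fidelity (rho_AAsB rho) (tens_id Phi rho))%:E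
            | Phi in [set Phi : {linear 'M[R[i]]_dA -> 'M[R[i]]_(dA * dA)}
                     | channel Phi]] M
     /\ (- M <= (reflected_entropy rho - mutual_information rho)%:E)%E).
Proof.
split; first exact: max_recovery_fidelity.
have [rho0 tr1] := rho_density.
have := max_recovery_fidelity (density_swap rho0 tr1).
rewrite reflected_entropy_swap // mutual_information_swap // => -[M [[[Phi ch E] ub] h]].
exists M; split => //; split.
  by exists Phi => //; rewrite fidelity_swap.
move=> _ [Psi chPsi <-]; apply: ub; exists Psi => //.
by rewrite fidelity_swap.
Qed.
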